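(* Let $\mathcal{H}_1$ and $\mathcal{H}_2$ be complex Hilbert spaces with $\dim \mathcal{H}_1, \dim \mathcal{H}_2 \geq 2$. Let $G$ be a uniquely 2-divisible abelian group and let $f : \mathcal{B}(\mathcal{H}_1, \mathcal{H}_2) \to G$ be an orthogonally additive mapping, with respect to the orthogonality defined by $$x \perp y \Longleftrightarrow x^*y=0.$$ Then there exist a unique additive mapping $T : \mathcal{B}(\mathcal{H}_1, \mathcal{H}_2) \to G$ and a symmetric biadditive orthogonality preserving mapping $B : \mathcal{B}(\mathcal{H}_1, \mathcal{H}_2) \times \mathcal{B}(\mathcal{H}_1, \mathcal{H}_2) \to G$ such that $$f(x)=T(x)+B(x,x)\quad\text{for all } x \in \mathcal{B}(\mathcal{H}_1, \mathcal{H}_2).$$ If $\mathcal{H}$ is a complex Hilbert space such that $\dim \mathcal{H} \geq 2$ (and $\mathcal{H}_1=\mathcal{H}_2=\mathcal{H}$, so that $f:\mathcal{B}(\mathcal{H})\to G$), $G$ is a complex Banach space and $f$ is continuous, then $T$ is continuous and there exists a unique continuous linear mapping $\Phi : \mathcal{B}(\mathcal{H}) \to G$ such that $$f(x)=T(x)+\Phi(x^*x)\quad\text{for all } x \in \mathcal{B}(\mathcal{H}).$$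
   Context: $\mathcal{B}(\mathcal{H}_1,\mathcal{H}_2)$ is the space of bounded linear operators from $\mathcal{H}_1$ to $\mathcal{H}_2$ and $\mathcal{B}(\mathcal{H})=\mathcal{B}(\mathcal{H},\mathcal{H})$, with the operator norm. A mapping $f$ is orthogonally additive if $x^*y=0$ implies $f(x+y)=f(x)+f(y)$. A mapping $B$ of two variables is orthogonality preserving if $x^*y=0$ implies $B(x,y)=0$; it is biadditive if it is additive in each variable. *)

(* Defs.v *)
From HB Require Import structures.
From mathcomp Require Import all_boot all_order all_algebra.
From mathcomp Require Import sesquilinear complex.
From mathcomp Require Import all_classical all_reals interval_inference topology normedtype.
From mathcomp Require Import ring lra.

Set Implicit Arguments.
Unset Strict Implicit.
Unset Printing Implicit Defensive.

Import Order.TTheory GRing.Theory Num.Theory.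
Import numFieldNormedType.Exports.

Local Open Scope ring_scope.
Local Open Scope classical_set_scope.
Local Open Scope complex_scope.

(* The inner product is linear in its first argument. *)
HB.mixin Record CompleteNormedModule_isHilbert (R : realType) H
    & CompleteNormedModule R[i] H := {
  hdot : {dot H for @Num.conj R[i]} ;
  hdot_norm : forall u : H, hdot u u = `|u| ^+ 2
}.

#[short(type="hilbertType")]
HB.structure Definition Hilbert (R : realType) :=
  {H of CompleteNormedModule R[i] H & CompleteNormedModule_isHilbert R H}.

Section RealComplex.
Variable R : realType.

Lemma realcD (a b : R) : (a + b)%:C = a%:C + b%:C.
Proof. exact: rmorphD. Qed.

Lemma realcM (a b : R) : (a * b)%:C = a%:C * b%:C.
Proof. exact: rmorphM. Qed.

End RealComplex.

Section BoundedOperators.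
Variables (R : realType) (V W : normedModType R[i]).

Definition bounded_linear : {pred V -> W} :=
  mem [set f : V -> W | linear f /\
    exists M : R, forall u, `|f u| <= M%:C * `|u| ].

Record bounded_op := BoundedOp {
  bounded_fun :> V -> W ;
  _ : bounded_fun \in bounded_linear
}.

HB.instance Definition _ := [isSub for bounded_fun].
HB.instance Definition _ := [Choice of bounded_op by <:].

Lemma bounded_opP (x : bounded_op) : linear x /\
  exists M : R, forall u, `|x u| <= M%:C * `|u|.
Proof. by case: x => f /=; rewrite inE. Qed.

Lemma bounded_linear_submod_closed : submod_closed bounded_linear.
Proof.
split.
  rewrite inE; split => [a u v|]; first by rewrite /= scaler0 addr0.
  by exists 0 => u; rewrite normr0 rmorph0 mul0r.
move=> a f g; rewrite !inE => -[flin [M fM]] [glin [N gN]]; split.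
  move=> b u v.
  rewrite [LHS]/(a *: f (b *: u + v) + g (b *: u + v)) flin glin.
  rewrite [RHS]/(b *: (a *: f u + g u) + (a *: f v + g v)).
  rewrite !scalerDr !scalerA [a * b]mulrC. exact: addrACA.
exists (complex.Re `|a| * M + N) => u.
rewrite realcD realcM RRe_real ?normr_real// mulrDl.
rewrite (le_trans (ler_normD _ _))// lerD// normrZ -mulrA.
by rewrite ler_wpM2l.
Qed.

HB.instance Definition _ :=
  GRing.isSubmodClosed.Build _ _ bounded_linear bounded_linear_submod_closed.
HB.instance Definition _ := [SubChoice_isSubLmodule of bounded_op by <:].

End BoundedOperators.

Section OperatorNorm.
Variables (R : realType) (V W : normedModType R[i]).
Implicit Types x y : bounded_op V W.

Lemma bounded_op_eqP x y : x = y <-> forall u, x u = y u.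
Proof. by split=> [-> //|xy]; apply/val_inj/funext. Qed.

Lemma bounded_addE x y u : (x + y) u = x u + y u. Proof. by []. Qed.
Lemma bounded_scaleE (a : R[i]) x u : (a *: x) u = a *: x u. Proof. by []. Qed.
Lemma bounded_zeroE u : (0 : bounded_op V W) u = 0. Proof. by []. Qed.

Lemma bounded_linearP x : linear x. Proof. by have [] := bounded_opP x. Qed.

Lemma bounded_op0 x : x 0 = 0.
Proof.
have /(_ 1 0 0) := bounded_linearP x.
by rewrite !scale1r addr0 => /eqP; rewrite -subr_eq subrr eq_sym => /eqP.
Qed.

Lemma bounded_opD x u v : x (u + v) = x u + x v.
Proof. by have /(_ 1 u v) := bounded_linearP x; rewrite !scale1r. Qed.

Lemma bounded_opZ x a u : x (a *: u) = a *: x u.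
Proof.
by have /(_ a u 0) := bounded_linearP x; rewrite !addr0 bounded_op0 addr0.
Qed.

Definition ball_image x : set R :=
  [set complex.Re `|x u| | u in [set u : V | `|u| <= 1]].

(* A norm takes its values in the scalar field, hence the cast to R[i]. *)
Definition op_norm x : R[i] := (sup (ball_image x))%:C.

Let has_sup_ball_image x : has_sup (ball_image x).
Proof.
split; first by exists (complex.Re `|x 0|), 0 => //=; rewrite normr0 ler01.
have [_ [M xM]] := bounded_opP x; exists `|M| => _ [u /= u1 <-].
rewrite -lecR RRe_real ?normr_real// (le_trans (xM u))//.
have MM : M%:C <= `|M|%:C :> R[i] by rewrite lecR ler_norm.
rewrite (le_trans (ler_wpM2r (normr_ge0 u) MM))// ler_piMr//.
by rewrite ler0c.
Qed.

Lemma op_norm_ub x u : `|x u| <= op_norm x * `|u|.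
Proof.
have [->|u0] := eqVneq u 0; first by rewrite bounded_op0 !normr0 mulr0.
rewrite -ler_pdivrMr ?normr_gt0//.
have -> : `|x u| / `|u| = `|x (`|u|^-1 *: u)|.
  by rewrite bounded_opZ normrZ normfV normr_id mulrC.
rewrite -[leLHS]RRe_real ?normr_real// lecR.
apply: sup_upper_bound; first exact: has_sup_ball_image.
exists (`|u|^-1 *: u) => //=.
by rewrite normrZ normfV normr_id mulVf// normr_eq0.
Qed.

Lemma op_norm_le x (M : R) : (forall u, `|u| <= 1 -> `|x u| <= M%:C) ->
  op_norm x <= M%:C.
Proof.
move=> xM; rewrite lecR; apply: ge_sup; first by case: (has_sup_ball_image x).
by move=> _ [u /= u1 <-]; rewrite -lecR RRe_real ?normr_real// xM.
Qed.

Lemma op_norm_ge0 x : 0 <= op_norm x.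
Proof.
rewrite ler0c; apply: (@le_trans _ _ (complex.Re `|x 0|)).
  by rewrite bounded_op0 normr0.
apply: sup_upper_bound; first exact: has_sup_ball_image.
by exists 0 => //=; rewrite normr0 ler01.
Qed.

Lemma ler_op_normD x y : op_norm (x + y) <= op_norm x + op_norm y.
Proof.
rewrite -realcD; apply: op_norm_le => u u1.
rewrite bounded_addE (le_trans (ler_normD _ _))// realcD.
by apply: lerD; apply: (le_trans (op_norm_ub _ u)); rewrite ler_piMr ?op_norm_ge0.
Qed.

Let op_normZ_le (a : R[i]) x : op_norm (a *: x) <= `|a| * op_norm x.
Proof.
rewrite -[`|a|]RRe_real ?normr_real// -realcM; apply: op_norm_le => u u1.
rewrite bounded_scaleE normrZ realcM RRe_real ?normr_real//.
rewrite ler_wpM2l// (le_trans (op_norm_ub _ u))// ler_piMr//.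
exact: op_norm_ge0.
Qed.

Lemma op_normZ (a : R[i]) x : op_norm (a *: x) = `|a| * op_norm x.
Proof.
have [->|a0] := eqVneq a 0.
  rewrite normr0 mul0r; apply/eqP; rewrite eq_le op_norm_ge0 andbT.
  by have := op_normZ_le 0 x; rewrite normr0 mul0r.
apply/eqP; rewrite eq_le op_normZ_le/= -ler_pdivlMl ?normr_gt0//.
rewrite -normfV; have := op_normZ_le a^-1 (a *: x).
by rewrite scalerA mulVf// scale1r.
Qed.

Lemma op_norm0_eq0 x : op_norm x = 0 -> x = 0.
Proof.
move=> x0; apply/bounded_op_eqP => u; apply/eqP; rewrite bounded_zeroE.
by rewrite -normr_le0 (le_trans (op_norm_ub x u))// x0 mul0r.
Qed.

HB.instance Definition _ := @Lmodule_isNormed.Build R[i] (bounded_op V W)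
  op_norm ler_op_normD op_normZ op_norm0_eq0.

Lemma op_normE x : `|x| = op_norm x. Proof. by []. Qed.

End OperatorNorm.

Section Composition.
Variables (R : realType) (U V W : normedModType R[i]).

Lemma bounded_comp_subproof (y : bounded_op V W) (x : bounded_op U V) :
  y \o x \in @bounded_linear R U W.
Proof.
rewrite inE; split=> [a u v|]; first by rewrite /= !bounded_linearP.
exists (sup (ball_image y) * sup (ball_image x)) => u.
rewrite (le_trans (op_norm_ub y (x u)))// realcM -mulrA.
by rewrite ler_wpM2l ?op_norm_ge0 ?op_norm_ub.
Qed.

Definition bounded_comp y x := BoundedOp (bounded_comp_subproof y x).

End Composition.

Section InnerProduct.
Variables (R : realType) (H : hilbertType R).
Implicit Types u v w : H.

Lemma hdotDl u v w : hdot (u + v) w = hdot u w + hdot v w.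
Proof. exact: linearDl. Qed.

Lemma hdotDr u v w : hdot u (v + w) = hdot u v + hdot u w.
Proof. exact: linearDr. Qed.

Lemma hdotZl a u v : hdot (a *: u) v = a * hdot u v.
Proof. exact: linearZl_LR. Qed.

Lemma hdotZr a u v : hdot u (a *: v) = Num.conj a * hdot u v.
Proof. exact: linearZr_LR. Qed.

Lemma hdotC u v : hdot u v = Num.conj (hdot v u).
Proof. by rewrite hermC expr0 mul1r. Qed.

Lemma ReC (z : R[i]) : complex.Re (Num.conj z) = complex.Re z.
Proof. by case: z. Qed.

Let rdot u v : R := complex.Re (hdot u v).

Lemma rdotC u v : rdot u v = rdot v u.
Proof. by rewrite /rdot hdotC ReC. Qed.

Lemma rdotDl u v w : rdot (u + v) w = rdot u w + rdot v w.
Proof. by rewrite /rdot hdotDl raddfD. Qed.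

Lemma ReZ (t : R) (z : R[i]) : complex.Re (t%:C * z) = t * complex.Re z.
Proof. by case: z => a b /=; rewrite mul0r subr0. Qed.

Lemma rdotZl (t : R) u v : rdot (t%:C *: u) v = t * rdot u v.
Proof. by rewrite /rdot hdotZl ReZ. Qed.

Lemma rdotDr u v w : rdot u (v + w) = rdot u v + rdot u w.
Proof. by rewrite ![rdot u _]rdotC rdotDl. Qed.

Lemma rdotZr (t : R) u v : rdot u (t%:C *: v) = t * rdot u v.
Proof. by rewrite ![rdot u _]rdotC rdotZl. Qed.

Lemma rdot_norm u : (rdot u u)%:C = `|u| ^+ 2.
Proof. by rewrite /rdot hdot_norm RRe_real// rpredX// normr_real. Qed.

Lemma rdot_ge0 u : 0 <= rdot u u.
Proof. by rewrite -ler0c rdot_norm exprn_ge0. Qed.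

Lemma discriminant (a b c : R) : 0 <= a ->
  (forall t, 0 <= a * t ^+ 2 + 2 * b * t + c) -> b ^+ 2 <= a * c.
Proof.
rewrite le_eqVlt => /predU1P[<-|a0] abc.
  have [->|b0] := eqVneq b 0; first by rewrite expr2 !mul0r.
  have := abc (- (c + 1) / (2 * b)); rewrite mul0r add0r.
  have -> : 2 * b * (- (c + 1) / (2 * b)) + c = -1 by field.
  by rewrite lerNr oppr0 ler10.
have := abc (- b / a).
have -> : a * (- b / a) ^+ 2 + 2 * b * (- b / a) + c = (a * c - b ^+ 2) / a.
  by field; rewrite gt_eqF.
by rewrite pmulr_lge0 ?invr_gt0// subr_ge0.
Qed.

Lemma rdot_sqr_le u v : rdot u v ^+ 2 <= rdot u u * rdot v v.
Proof.
apply: discriminant => [|t]; first exact: rdot_ge0.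
have := rdot_ge0 (t%:C *: u + v).
rewrite rdotDl !rdotDr !rdotZl !rdotZr (rdotC v u); congr (_ <= _); ring.
Qed.

Let nrm u : R := complex.Re `|u|.

Lemma nrmE u : (nrm u)%:C = `|u|.
Proof. by rewrite RRe_real// normr_real. Qed.

Lemma nrm_ge0 u : 0 <= nrm u.
Proof. by rewrite -ler0c nrmE. Qed.

Lemma nrm_sqr u : nrm u ^+ 2 = rdot u u.
Proof. by apply: complexI; rewrite rmorphXn/= rdot_norm nrmE. Qed.

Lemma rdot_le u v : rdot u v <= nrm u * nrm v.
Proof.
rewrite (le_trans (ler_norm _))// -(@ler_pXn2r _ 2)// ?nnegrE ?mulr_ge0 ?nrm_ge0//.
by rewrite real_normK ?num_real// exprMn !nrm_sqr rdot_sqr_le.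
Qed.

Section Riesz.
Variables (phi : H -> R[i]) (M : R).
Hypotheses (phiD : {morph phi : u v / u + v})
  (phiZ : forall a u, phi (a *: u) = a * phi u)
  (phiM : forall u, complex.Re (phi u) <= M * nrm u).

Let psi u : R := complex.Re (phi u).
Let J u : R := rdot u u - 2 * psi u.

Let psiD u v : psi (u + v) = psi u + psi v.
Proof. by rewrite /psi phiD raddfD. Qed.

Let psiZ (t : R) u : psi (t%:C *: u) = t * psi u.
Proof. by rewrite /psi phiZ ReZ. Qed.

Let J_lb u : - M ^+ 2 <= J u.
Proof.
have := phiM u; rewrite -/(psi u) /J -nrm_sqr => h.
have := sqr_ge0 (nrm u - M); nra.
Qed.

Let m := inf (range J).

Let has_inf_J : has_inf (range J).
Proof.
split; first by exists (J 0), 0.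
by exists (- M ^+ 2) => _ [u _ <-].
Qed.

Let m_le u : m <= J u.
Proof. by apply: (ge_inf has_inf_J.2); exists u. Qed.

Let parallelogram e u v : J u < m + e -> J v < m + e ->
  rdot (u - v) (u - v) <= 4 * e.
Proof.
move=> ue ve; have := m_le ((2^-1)%:C *: (u + v)); move: ue ve.
rewrite -[- v]scaleN1r -[X in X *: v](_ : (-1)%:C = -1); last by rewrite rmorphN1.
rewrite /J !(psiZ, psiD, rdotDl, rdotDr, rdotZl, rdotZr) (rdotC v u).
lra.
Qed.

Let variation e w v : J w < m + e ->
  (rdot w v - psi v) ^+ 2 <= e * rdot v v.
Proof.
move=> we; rewrite [leRHS]mulrC; apply: discriminant => [|t].
  exact: rdot_ge0.
have := m_le (w + t%:C *: v); move: we.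
rewrite /J !(psiZ, psiD, rdotDl, rdotDr, rdotZl, rdotZr) (rdotC v w).
nra.
Qed.

Let approx (n : nat) : exists w, J w < m + n.+1%:R^-1.
Proof.
have [_ [w _ <-] wm] := @inf_adherent _ (range J) n.+1%:R^-1 ltac:(by rewrite invr_gt0) has_inf_J.
by exists w.
Qed.

Let w_ (n : nat) : H := projT1 (cid (approx n)).
Let w_J n : J (w_ n) < m + n.+1%:R^-1.
Proof. by rewrite /w_; case: cid. Qed.

Let inv_small (e : R) : 0 < e -> \forall n \near \oo, n.+1%:R^-1 < e.
Proof. by move=> e0; exact: (near_infty_natSinv_lt (PosNum e0)). Qed.

Let nrm_lt u (e : R) : 0 < e -> rdot u u < e ^+ 2 -> nrm u < e.
Proof.
by move=> e0; rewrite -nrm_sqr ltr_pXn2r// nnegrE ?nrm_ge0// ltW.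
Qed.

Let gt0_real (e : R[i]) : 0 < e -> exists2 r : R, 0 < r & e = r%:C.
Proof.
by case: e => a b; rewrite ltcE /= => /andP[/eqP -> a0]; exists a.
Qed.

Let w_cauchy : cauchy (w_ @ \oo).
Proof.
apply: cauchy_exP => _ /gt0_real[e e0 ->].
have [N _ NE] := inv_small (ltac:(by rewrite divr_gt0 ?exprn_gt0) : 0 < e ^+ 2 / 4).
exists (w_ N), N => // n /= Nn.
rewrite -ball_normE /= -nrmE ltcR; apply: nrm_lt => //.
have := NE N (leqnn N) => /=; set d := _^-1 => de.
rewrite (@le_lt_trans _ _ (4 * d))//; last lra.
apply: parallelogram; first exact: w_J.
by rewrite (lt_le_trans (w_J n))// lerD2l lef_pV2 ?posrE// ler_nat.
Qed.

Lemma riesz : exists w, forall u, phi u = hdot u w.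
Proof.
have wcvg : cvg (w_ @ \oo) by exact: (cauchy_cvg (w_ @ \oo) w_cauchy).
have wl : w_ @ \oo --> lim (w_ @ \oo) := wcvg.
set l := lim _ in wl.
have close e : 0 < e -> exists w, J w < m + e /\ rdot (l - w) (l - w) < e.
  move=> e0; have se0 : 0 < (Num.sqrt e)%:C :> R[i] by rewrite ltcR sqrtr_gt0.
  move/cvgrPdist_lt: wl => /(_ _ se0) wl.
  near \oo => n; exists (w_ n); split.
    by rewrite (lt_trans (w_J n))// ltrD2l; near: n; exact: inv_small.
  rewrite -nrm_sqr -[ltRHS]sqr_sqrtr ?ltW// ltr_pXn2r ?nnegrE ?nrm_ge0//.
  by rewrite -ltcR nrmE; near: n.
have re v : psi v = rdot v l.
  apply/eqP; rewrite eq_sym -subr_eq0 rdotC -sqrf_eq0 eq_le sqr_ge0 andbT.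
  apply/ler_addgt0Pr => e e0; rewrite add0r.
  set K := 4 * (rdot v v + 1).
  have K0 : 0 < K by rewrite mulr_gt0// ltr_wpDl// rdot_ge0.
  have [w [wJ lw]] := close (e / K) ltac:(by rewrite divr_gt0).
  have h1 := variation v wJ; have h2 := rdot_sqr_le (l - w) v.
  have h3 : rdot (l - w) (l - w) * rdot v v <= e / K * rdot v v.
    by rewrite ler_wpM2r ?rdot_ge0// ltW.
  have h4 : e / K * rdot v v * 4 <= e.
    rewrite -mulrA [leLHS]mulrAC ler_pdivrMr// ler_wpM2l ?ltW// /K; lra.
  have -> : rdot l v - psi v = rdot (l - w) v + (rdot w v - psi v).
    by rewrite addrA -rdotDl subrK.
  move: h1 h2 h3 h4; set x := rdot (l - w) v; set y := _ - psi v.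
  have := sqr_ge0 (x - y); nra.
exists l => u; apply/eqP; rewrite eq_complex; apply/andP; split.
  by apply/eqP; exact: re.
have := re ('i%C *: u); rewrite /psi /rdot phiZ hdotZl.
by case: (phi u) (hdot u l) => a b [c d] /=; rewrite !mul0r !mul1r !sub0r => /oppr_inj ->.
Unshelve. all: by end_near. Qed.
End Riesz.

End InnerProduct.

Section Adjoint.
Variables (R : realType) (H1 H2 : hilbertType R).

Lemma hdotr_inj (H : hilbertType R) (v w : H) :
  (forall u, hdot u v = hdot u w) -> v = w.
Proof.
move=> vw; apply/eqP; rewrite -subr_eq0 -normr_eq0 -sqrf_eq0 -hdot_norm.
by rewrite hdotDr -scaleN1r hdotZr vw rmorphN rmorph1 mulN1r subrr.
Qed.

Lemma adjoint_exists (x : bounded_op H1 H2) :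
  exists a : bounded_op H2 H1, forall u v, hdot (x u) v = hdot u (a v).
Proof.
have Re_le (H : hilbertType R) (u v : H) : (complex.Re (hdot u v))%:C <= `|u| * `|v|.
  by rewrite -(nrmE u) -(nrmE v) -realcM lecR; exact: rdot_le.
have /choice[a aE] v : exists w, forall u, hdot (x u) v = hdot u w.
  apply: (@riesz _ _ _ (complex.Re (`|x| * `|v|))).
  - by move=> u w; rewrite bounded_opD hdotDl.
  - by move=> c u; rewrite bounded_opZ hdotZl.
  - move=> u; rewrite -lecR realcM nrmE.
    have -> : (complex.Re (`|x| * `|v|))%:C = `|x| * `|v|.
      by rewrite RRe_real// realM// normr_real.
    rewrite (le_trans (Re_le _ _ _))// mulrAC ler_wpM2r//.
    exact: op_norm_ub.
have alin : linear a.
  move=> c u v; apply: hdotr_inj => w.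
  by rewrite -aE !hdotDr !hdotZr !aE.
have abd : exists M : R, forall v, `|a v| <= M%:C * `|v|.
  exists (complex.Re `|x|) => v; rewrite RRe_real ?normr_real//.
  have [->|av0] := eqVneq (a v) 0; first by rewrite normr0 mulr_ge0.
  rewrite -(ler_pM2r (_ : 0 < `|a v|)) ?normr_gt0// -expr2 -hdot_norm -aE.
  rewrite -[leLHS]RRe_real; last by rewrite aE hdot_norm rpredX// normr_real.
  rewrite (le_trans (Re_le _ _ _))// mulrAC ler_wpM2r//.
  exact: op_norm_ub.
have aP : a \in @bounded_linear R H2 H1 by rewrite inE.
by exists (BoundedOp aP) => u v; rewrite aE.
Qed.

Definition adjoint (x : bounded_op H1 H2) : bounded_op H2 H1 := projT1 (cid (adjoint_exists x)).

Lemma adjointP (x : bounded_op H1 H2) u v : hdot (x u) v = hdot u (adjoint x v).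
Proof. by rewrite /adjoint; case: cid. Qed.

Lemma adjoint_unique (x : bounded_op H1 H2) (a : bounded_op H2 H1) :
  (forall u v, hdot (x u) v = hdot u (a v)) -> a = adjoint x.
Proof.
move=> aE; apply/bounded_op_eqP => v; apply: hdotr_inj => u.
by rewrite -aE adjointP.
Qed.

End Adjoint.

Definition dim_ge (K : nzRingType) (n : nat) (V : lmodType K) : Prop :=
  exists e : 'I_n -> V, forall c : 'I_n -> K,
    \sum_(i < n) c i *: e i = 0 -> forall i, c i = 0.

Definition uniquely_divisible (n : nat) (G : zmodType) : Prop :=
  forall g : G, exists! h : G, h *+ n = g.

Definition additive_map (V G : zmodType) (T : V -> G) : Prop :=
  {morph T : x y / x + y}.

Definition biadditive_map (V G : zmodType) (B : V -> V -> G) : Prop :=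
  (forall y, additive_map (fun x => B x y)) /\ (forall x, additive_map (B x)).

Section OrthogonalAdditivity.
Variables (R : realType) (H1 H2 : hilbertType R) (G : zmodType).

Definition op_orthogonal (x y : bounded_op H1 H2) : Prop :=
  bounded_comp (adjoint x) y = 0.

Definition orthogonally_additive (f : bounded_op H1 H2 -> G) : Prop :=
  forall x y, op_orthogonal x y -> f (x + y) = f x + f y.

Definition orthogonality_preserving
    (B : bounded_op H1 H2 -> bounded_op H1 H2 -> G) : Prop :=
  forall x y, op_orthogonal x y -> B x y = 0.

Definition quadratic_decomposition (f T : bounded_op H1 H2 -> G) : Prop :=
  additive_map T /\
  exists B : bounded_op H1 H2 -> bounded_op H1 H2 -> G,
    [/\ forall x y, B x y = B y x, biadditive_map B,
        orthogonality_preserving B &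
        forall x, f x = T x + B x x].

End OrthogonalAdditivity.

(* Main.v *)
Require Import Defs.
From HB Require Import structures.
From mathcomp Require Import all_boot all_order all_algebra.
From mathcomp Require Import sesquilinear complex.
From mathcomp Require Import all_classical all_reals topology normedtype.
From mathcomp Require Import ring lra.

Set Implicit Arguments.
Unset Strict Implicit.
Unset Printing Implicit Defensive.

Import Order.TTheory GRing.Theory Num.Theory.
Import numFieldNormedType.Exports.

Local Open Scope ring_scope.
Local Open Scope classical_set_scope.
Local Open Scope complex_scope.

(* Let [D x y = f (x + y) - f x - f y].  If [v] is a partial isometry of [H2] with
   [v v = 0], then [v^* v x + v a] and [v^* v y + v b] are orthogonal as soon as
   [x^* v^* v y + a^* v^* v b = 0], so in that case [D (v^* v x) (v^* v y)] is the
   opposite of [D (v a) (v b)].  Playing this against the cocycle identity of [D]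
   shows that [D] is biadditive on operators with range in the initial space of
   [v] and depends there only on [x^* v^* v y].
   The identity of [H2] is a sum of three such initial projections, those of [u],
   [u^*] and [w]: Zorn's lemma gives a maximal partial isometry [u] with [u u = 0],
   and what is left over has dimension at most one, hence is handled by a rank one
   [w].  So [D] is biadditive on all operators, and [B = D / 2], [T x = f x - B x x].
   The operators [a] with [D (a x) y = D x (a^* y)] form a *-algebra which contains
   [u], [w] and the corner of [u^* u]; these generate every operator, whence
   [B x x = B 1 (x^* x)]. *)

(** * Shift relations *)

Section InnerProductTheory.
Variables (R : realType) (H : hilbertType R).
Implicit Types u v : H.

Lemma hdotNl u v : hdot (- u) v = - hdot u v.
Proof. by rewrite -scaleN1r hdotZl mulN1r. Qed.

Lemma hdotNr u v : hdot u (- v) = - hdot u v.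
Proof. by rewrite -scaleN1r hdotZr rmorphN rmorph1 mulN1r. Qed.

Lemma hdot0l v : hdot 0 v = 0.
Proof. by rewrite -(scale0r 0) hdotZl mul0r. Qed.

Lemma hdot0r u : hdot u 0 = 0.
Proof. by rewrite hdotC hdot0l rmorph0. Qed.

Lemma rdotNl u v : complex.Re (hdot (- u) v) = - complex.Re (hdot u v).
Proof. by rewrite hdotNl raddfN. Qed.

Lemma rdotNr u v : complex.Re (hdot u (- v)) = - complex.Re (hdot u v).
Proof. by rewrite hdotNr raddfN. Qed.

End InnerProductTheory.

(** * Nearest points in the domain of a closed isometric relation *)

Section RelationProjection.
Variables (R : realType) (H : hilbertType R) (G : set (H * H)).
Hypotheses (G0 : G 0) (Glin : forall a g h, G g -> G h -> G (a *: g + h)).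
Hypotheses (Giso : forall g, G g -> hdot g.1 g.1 = hdot g.2 g.2).
Hypothesis Gclosed : closed G.
Variable x : H.

Let J (g : H * H) : R := complex.Re (hdot (x - g.1) (x - g.1)).

Let has_inf_J : has_inf (J @` G).
Proof.
split; first by exists (J 0), 0.
by exists 0 => _ [g _ <-]; exact: rdot_ge0.
Qed.

Let m := inf (J @` G).

Let m_le g : G g -> m <= J g.
Proof. by move=> Gg; apply: (ge_inf has_inf_J.2); exists g. Qed.

(** The midpoint of [g] and [h] lies in [G], so [J] is at least [m] there; the parallelogram law
    turns this into a bound on the difference of the first coordinates. *)
Let parallelogram e g h : G g -> G h -> J g < m + e -> J h < m + e ->
  complex.Re (hdot (g.1 - h.1) (g.1 - h.1)) <= 4 * e.
Proof.
move=> Gg Gh ge he.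
have : G ((2^-1)%:C *: g + ((2^-1)%:C *: h + 0)) by apply: (Glin _ Gg); exact: Glin.
rewrite addr0 => /m_le; move: ge he.
rewrite /J /= !(rdotDl, rdotDr, rdotNl, rdotNr, rdotZl, rdotZr)
  ?(rdotC g.1 x) ?(rdotC h.1 x) ?(rdotC h.1 g.1).
lra.
Qed.

(** Moving from [g] along [t h] keeps [J] above [m], which gives a nonnegative quadratic polynomial
    in [t]; the bound is its discriminant inequality. *)
Let variation e g h : G g -> G h -> J g < m + e ->
  complex.Re (hdot (x - g.1) h.1) ^+ 2 <= e * complex.Re (hdot h.1 h.1).
Proof.
move=> Gg Gh ge; rewrite [leRHS]mulrC -sqrrN; apply: discriminant => [|t].
  exact: rdot_ge0.
have := m_le (Glin t%:C Gh Gg); move: ge.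
rewrite /J /= opprD addrCA !(rdotDl (- (_ *: _))) !(rdotDr _ (- (_ *: _))).
rewrite !(rdotNl (_ *: _), rdotNr _ (_ *: _)) !(rdotZl, rdotZr) (rdotC h.1 (x - _)).
nra.
Qed.

Let approx (n : nat) : exists g, G g /\ J g < m + n.+1%:R^-1.
Proof.
have n0 : 0 < n.+1%:R^-1 :> R by rewrite invr_gt0.
have [_ [g Gg <-] gm] := inf_adherent n0 has_inf_J.
by exists g.
Qed.

Let g_ (n : nat) : H * H := projT1 (cid (approx n)).

Let g_G n : G (g_ n). Proof. by rewrite /g_; case: cid => ? []. Qed.

Let g_J n : J (g_ n) < m + n.+1%:R^-1.
Proof. by rewrite /g_; case: cid => ? []. Qed.

Let inv_small (e : R) : 0 < e -> \forall n \near \oo, n.+1%:R^-1 < e.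
Proof. by move=> e0; exact: (near_infty_natSinv_lt (interval_inference.PosNum e0)). Qed.

Let nrm_lt (u : H) (e : R) : 0 < e -> complex.Re (hdot u u) < e ^+ 2 -> `|u| < e%:C.
Proof.
move=> e0; rewrite -nrm_sqr ltr_pXn2r ?nnegrE ?nrm_ge0 1?ltW// => ue.
by rewrite -nrmE ltcR.
Qed.

(** Here [k] stands for either coordinate projection: on [G] both have the same norm, so the
    parallelogram bound serves both. *)
Let proj_cauchy (k : H * H -> H) : {morph k : g h / g - h >-> g - h} ->
  (forall g, G g -> complex.Re (hdot (k g) (k g)) = complex.Re (hdot g.1 g.1)) ->
  cauchy (k \o g_ @ \oo).
Proof.
move=> kB kiso; apply: cauchy_exP => -[e e'].
rewrite ltcE /= => /andP[/eqP -> e0].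
have [N _ NE] := inv_small (ltac:(by rewrite divr_gt0 ?exprn_gt0) : 0 < e ^+ 2 / 4).
exists (k (g_ N)), N => // n /= Nn.
rewrite -ball_normE /=; apply: nrm_lt => //; rewrite -kB kiso; last first.
  by rewrite addrC -scaleN1r; apply: Glin.
have := NE N (leqnn N) => /=; set d := _^-1 => de.
rewrite (@le_lt_trans _ _ (4 * d))//; last lra.
apply: parallelogram => //.
by rewrite (lt_le_trans (g_J n))// lerD2l lef_pV2 ?posrE// ler_nat.
Qed.

(* Minimizing sequences for the distance to the domain converge together with
   their images, since the relation is isometric. *)
Lemma isometric_relation_proj :
  exists2 g, G g & forall h, G h -> hdot (x - g.1) h.1 = 0.
Proof.
have /cauchy_cvg/cvg_ex[a a_] : cauchy (fst \o g_ @ \oo).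
  by apply: proj_cauchy => [[p q] [r s]|].
have /cauchy_cvg/cvg_ex[b b_] : cauchy (snd \o g_ @ \oo).
  by apply: proj_cauchy => [[p q] [r s]|g Gg] //; rewrite Giso.
have Gab : G (a, b).
  have gG : \forall n \near \oo, G (g_ n) by near=> n; exact: g_G.
  apply: (closed_cvg _ Gclosed gG).
  have -> : g_ = fun n => ((g_ n).1, (g_ n).2).
    by apply/funext => n; rewrite -surjective_pairing.
  exact: (cvg_pair a_ b_).
exists (a, b) => // h Gh /=.
have close e : 0 < e -> exists w, [/\ G w, J w < m + e &
    complex.Re (hdot (a - w.1) (a - w.1)) < e].
  move=> e0; have se0 : 0 < (Num.sqrt e)%:C :> R[i] by rewrite ltcR sqrtr_gt0.
  move/cvgrPdist_lt: a_ => /(_ _ se0) al.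
  near \oo => n; exists (g_ n); split => //.
    by rewrite (lt_trans (g_J n))// ltrD2l; near: n; exact: inv_small.
  rewrite -nrm_sqr -[ltRHS]sqr_sqrtr ?ltW// ltr_pXn2r ?nnegrE ?nrm_ge0 ?sqrtr_ge0//.
  by rewrite -ltcR nrmE; near: n.
have re k : G k -> complex.Re (hdot (x - a) k.1) = 0.
  move=> Gk; apply/eqP; rewrite -sqrf_eq0 eq_le sqr_ge0 andbT.
  apply/ler_addgt0Pr => d d0; rewrite add0r.
  (* With [w] chosen for [d / K], both [r ^+ 2] and [q ^+ 2] below are at most [d / K] times the
     squared norm of [k.1], and [(r - q) ^+ 2 <= 2 r ^+ 2 + 2 q ^+ 2]; the factor 4 makes this at
     most [d], and the summand 1 keeps [K] positive. *)
  set K := 4 * (complex.Re (hdot k.1 k.1) + 1).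
  have k0 := rdot_ge0 k.1.
  have K0 : 0 < K by rewrite mulr_gt0// ltr_wpDl.
  have dK : 0 < d / K by rewrite divr_gt0.
  have [w [Gw wJ aw]] := close _ dK.
  have h1 := variation Gw Gk wJ; have h2 := rdot_sqr_le (a - w.1) k.1.
  have h3 : complex.Re (hdot (a - w.1) (a - w.1)) * complex.Re (hdot k.1 k.1)
      <= d / K * complex.Re (hdot k.1 k.1).
    by rewrite ler_wpM2r// ltW.
  have h4 : d / K * complex.Re (hdot k.1 k.1) * 4 <= d.
    rewrite -mulrA [leLHS]mulrAC ler_pdivrMr// ler_wpM2l ?ltW// /K; lra.
  have : complex.Re (hdot (x - w.1) k.1) =
      complex.Re (hdot (x - a) k.1) + complex.Re (hdot (a - w.1) k.1).
    by rewrite -rdotDl addrA subrK.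
  move: h1 h2 h3 h4; set p := complex.Re (hdot (x - a) _).
  set q := complex.Re (hdot (a - _) k.1).
  set r := complex.Re (hdot (x - w.1) _).
  have := sqr_ge0 (r + q) => h5 h1 h2 h3 h4 rE.
  have -> : p = r - q by rewrite rE addrK.
  nra.
apply/eqP; rewrite eq_complex re//=; apply/andP; split=> //.
(* The real part at ['i h] is the imaginary part at [h]. *)
have := re _ (Glin 'i%C Gh G0); rewrite addr0 /= hdotZr.
by case: (hdot _ h.1) => c d /=; rewrite mul0r sub0r mulN1r opprK => ->.
Unshelve. all: by end_near. Qed.

End RelationProjection.

(** * Cauchy-Schwarz inequality and continuity of the inner product *)

Section HdotContinuity.
Variables (R : realType) (H : hilbertType R).
Implicit Types u v w : H.

(** Multiplying [u] by the conjugate of [hdot u v] makes the inner product real, which reduces the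
    claim to the bound on real parts. *)
Lemma hdot_le u v : `|hdot u v| <= `|u| * `|v|.
Proof.
have [->|uv0] := eqVneq (hdot u v) 0; first by rewrite normr0 mulr_ge0.
rewrite -(ler_pM2l (_ : 0 < `|hdot u v|)) ?normr_gt0// -expr2 normCKC mulrA.
rewrite -hdotZl -[X in X * `|u|]norm_conjC -normrZ.
have /RRe_real <- : hdot ((hdot u v)^* *: u) v \is Num.real.
  by rewrite hdotZl -normCKC rpredX// normr_real.
by rewrite -(nrmE (_ *: _)) -(nrmE v) -rmorphM lecR; exact: rdot_le.
Qed.

Lemma hdotl_continuous v : continuous (fun u => hdot u v : R[i]^o).
Proof.
move=> u; have v0 : 0 < `|v| + 1 by rewrite ltr_wpDl.
apply/cvgrPdist_le => e e0; near=> w.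
rewrite -hdotNl -hdotDl; apply: le_trans (hdot_le _ _) _.
apply: (@le_trans _ _ (`|u - w| * (`|v| + 1))); first by rewrite ler_wpM2l// lerDl.
rewrite -ler_pdivlMr//; near: w.
by apply: cvgr_dist_le; [exact: cvg_id|rewrite divr_gt0].
Unshelve. all: by end_near. Qed.

Lemma hdotr_continuous v : continuous (fun u => hdot v u : R[i]^o).
Proof.
move=> u; apply/cvgrPdist_le => e e0; near=> w.
rewrite -hdotNr -hdotDr hdotC norm_conjC hdotDl hdotNl.
near: w; exact: (cvgr_dist_le _ _ (@hdotl_continuous v u) _ e0).
Unshelve. all: by end_near. Qed.

End HdotContinuity.

Section ShiftRelations.
Variables (R : realType) (H : hilbertType R).

(* Graphs of partially defined isometries with range orthogonal to the domain. *)
Definition shift_relation (G : set (H * H)) : Prop :=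
  (forall a g h, G g -> G h -> G (a *: g + h)) /\
  (forall g h, G g -> G h -> hdot g.1 h.2 = 0 /\ hdot g.1 h.1 = hdot g.2 h.2).

Lemma closure_subset_closed (T : topologicalType) (A C : set T) :
  closed C -> A `<=` C -> closure A `<=` C.
Proof. by move=> Cc AC; apply: subset_trans Cc; exact: closureS. Qed.

Lemma closure_preimage (T U : topologicalType) (A : set T) (C : set U) (f : T -> U) :
  continuous f -> closed C -> (forall x, A x -> C (f x)) ->
  forall x, closure A x -> C (f x).
Proof.
move=> /continuous_closedP fc Cc AC; apply: closure_subset_closed => //.
exact: fc.
Qed.

Lemma pair_continuous (T U V : topologicalType) (f : T -> U) (g : T -> V) :
  continuous f -> continuous g -> continuous (fun x => (f x, g x)).
Proof. by move=> fc gc x; exact: cvg_pair (fc x) (gc x). Qed.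

Lemma shift_relation_closure (G : set (H * H)) :
  shift_relation G -> shift_relation (closure G).
Proof.
move=> [Glin Gort]; split.
  move=> a g h Gg; move: h; apply: closure_preimage => [||h Gh].
  - by move=> h; apply: cvgD; [exact: cvg_cst|exact: cvg_id].
  - exact: closed_closure.
  move: g Gg; apply: closure_preimage => [||g Gg].
  - by move=> g; apply: cvgD; [apply: cvgZr; exact: cvg_id|exact: cvg_cst].
  - exact: closed_closure.
  by apply: subset_closure; exact: Glin.
(* Both required identities become the vanishing of one map, continuous in each argument; its zero
   set is closed, so each argument in turn may pass to the closure. *)
pose F (g h : H * H) : R[i]^o * R[i]^o := (hdot g.1 h.2, hdot g.1 h.1 - hdot g.2 h.2).
have FG g h : G g -> G h -> F g h = 0.
  by move=> Gg /(Gort _ _ Gg)[e1 e2]; rewrite /F e1 e2 subrr.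
have c0 : closed [set (0 : R[i]^o * R[i]^o)].
  exact/accessible_closed_set1/hausdorff_accessible/norm_hausdorff.
suff FcG g h : closure G g -> closure G h -> F g h = 0.
  move=> g h Gg /(FcG _ _ Gg)[-> /eqP]; by rewrite subr_eq0 => /eqP.
move=> Gg; move: h; apply: (closure_preimage _ c0).
  apply: (@pair_continuous _ R[i]^o R[i]^o) => h.
    by apply: (cvg_comp _ _ cvg_snd); exact: hdotr_continuous.
  apply: cvgB; first by apply: (cvg_comp _ _ cvg_fst); exact: hdotr_continuous.
  by apply: (cvg_comp _ _ cvg_snd); exact: hdotr_continuous.
have l1 v : continuous (fun k : H * H => hdot k.1 v : R[i]^o).
  move=> k; apply: (@continuous_comp _ _ _ fst (fun u : H => hdot u v : R[i]^o)).
    exact: cvg_fst.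
  exact: hdotl_continuous.
have l2 v : continuous (fun k : H * H => hdot k.2 v : R[i]^o).
  move=> k; apply: (@continuous_comp _ _ _ snd (fun u : H => hdot u v : R[i]^o)).
    exact: cvg_snd.
  exact: hdotl_continuous.
move=> h Gh; move: g Gg; apply: (closure_preimage _ c0).
  apply: (@pair_continuous _ R[i]^o R[i]^o) => [|k]; first exact: l1.
  by apply: cvgB; [exact: l1|exact: l2].
by move=> g Gg; exact: FG.
Qed.

End ShiftRelations.

(** * Maximal shift relations *)

Section ShiftRelationMax.
Variables (R : realType) (H : hilbertType R).

Lemma shift_relation_bigcup (F : set (set (H * H))) :
  F `<=` @shift_relation R H -> total_on F subset ->
  shift_relation (\bigcup_(X in F) X).
Proof.
move=> Fshift Ftot.
have common g h : (\bigcup_(X in F) X) g -> (\bigcup_(X in F) X) h ->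
    exists2 X, F X & X g /\ X h.
  move=> [X FX Xg] [Y FY Yh]; have [XY|YX] := Ftot _ _ FX FY.
    by exists Y => //; split => //; exact: XY.
  by exists X => //; split => //; exact: YX.
split=> [a g h Ug Uh|g h Ug Uh]; have [X FX [Xg Xh]] := common _ _ Ug Uh.
  by exists X => //; apply: (Fshift _ FX).1.
exact: (Fshift _ FX).2.
Qed.

Lemma shift_relation_extend (G : set (H * H)) (c d : H) :
  shift_relation G -> hdot c d = 0 -> hdot c c = hdot d d ->
  (forall g, G g -> [/\ hdot c g.1 = 0, hdot c g.2 = 0,
                        hdot d g.1 = 0 & hdot d g.2 = 0]) ->
  shift_relation [set k | exists a, exists2 g, G g & k = a *: (c, d) + g].
Proof.
move=> [Glin Gort] cd ccdd cdG; split.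
  move=> a _ _ [b [g Gg ->]] [b' [g' Gg' ->]].
  exists (a * b + b'); exists (a *: g + g'); first exact: Glin.
  by rewrite scalerDr scalerA addrACA -scalerDl.
move=> _ _ [b [g Gg ->]] [b' [g' Gg' ->]] /=.
have [cg1 cg2 dg1 dg2] := cdG _ Gg; have [cg1' cg2' dg1' dg2'] := cdG _ Gg'.
have [gg gg'] := Gort _ _ Gg Gg'.
rewrite !(hdotDl, hdotDr, hdotZl, hdotZr) cg1' cg2' dg2' cd gg gg' ccdd.
rewrite (hdotC g.1 d) dg1 (hdotC g.1 c) cg1 (hdotC g.2 d) dg2 rmorph0.
by rewrite !(mulr0, addr0).
Qed.

Lemma shift_relation_max : exists G : set (H * H),
  [/\ shift_relation G, G 0, closed G &
      forall K, shift_relation K -> G `<=` K -> K `<=` G].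
Proof.
have [G [Gshift Gmax]] := Zorn_bigcup shift_relation_bigcup.
have {}Gmax K : shift_relation K -> G `<=` K -> K `<=` G.
  move=> Kshift GK; apply: contrapT => KG.
  by apply: (Gmax K) => //; split.
(* The empty relation is a shift relation too; maximality excludes it because [[set 0]] is a larger
   one. *)
have G0 : G 0.
  have [/eqP G0|/set0P[g Gg]] := boolP (G == set0).
    apply: (Gmax [set 0]); rewrite ?G0//.
    split=> [a g h|g h] -> ->; first by rewrite /= scaler0 addr0.
    by rewrite /= !hdot0l.
  by have := Gshift.1 (-1) _ _ Gg Gg; rewrite scaleN1r addNr.
exists G; split=> //; apply: Gmax; first exact: shift_relation_closure.
exact: subset_closure.
Qed.

End ShiftRelationMax.

Notation "x \c y" := (bounded_comp x y) (at level 40, left associativity).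
Notation "x ^†" := (adjoint x) (at level 2, format "x ^†").

(** * Bounded operators *)

Section OperatorAlgebra.
Variable R : realType.

Section Composition.
Variables (U V W X : normedModType R[i]).

Lemma bounded_compA (z : bounded_op W X) (y : bounded_op V W) (x : bounded_op U V) :
  z \c (y \c x) = z \c y \c x.
Proof. by apply/bounded_op_eqP. Qed.

Lemma bounded_compDl (y z : bounded_op V W) (x : bounded_op U V) :
  (y + z) \c x = y \c x + z \c x.
Proof. by apply/bounded_op_eqP. Qed.

Lemma bounded_compDr (y : bounded_op V W) (x z : bounded_op U V) :
  y \c (x + z) = y \c x + y \c z.
Proof. by apply/bounded_op_eqP => u; rewrite bounded_addE /= bounded_opD. Qed.

Lemma bounded_comp0l (x : bounded_op U V) : (0 : bounded_op V W) \c x = 0.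
Proof. by apply/bounded_op_eqP. Qed.

Lemma bounded_comp0r (y : bounded_op V W) : y \c (0 : bounded_op U V) = 0.
Proof. by apply/bounded_op_eqP => u; exact: bounded_op0. Qed.

Lemma bounded_compNl (y : bounded_op V W) (x : bounded_op U V) :
  (- y) \c x = - (y \c x).
Proof. by apply/bounded_op_eqP. Qed.

Lemma bounded_compNr (y : bounded_op V W) (x : bounded_op U V) :
  y \c (- x) = - (y \c x).
Proof.
by apply/eqP; rewrite -addr_eq0 -bounded_compDr addNr bounded_comp0r.
Qed.

End Composition.

Lemma bounded_id_subproof (V : normedModType R[i]) : id \in @bounded_linear R V V.
Proof. by rewrite inE; split => //; exists 1 => u; rewrite mul1r. Qed.

Definition bounded_id V := BoundedOp (bounded_id_subproof V).

Lemma bounded_comp1l (V W : normedModType R[i]) (x : bounded_op V W) :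
  bounded_id W \c x = x.
Proof. by apply/bounded_op_eqP. Qed.

Lemma bounded_comp1r (V W : normedModType R[i]) (x : bounded_op V W) :
  x \c bounded_id V = x.
Proof. by apply/bounded_op_eqP. Qed.

Variables H1 H2 H3 : hilbertType R.
Implicit Types x y : bounded_op H1 H2.

Lemma adjointK x : x^†^† = x.
Proof. by apply/esym/adjoint_unique => u v; rewrite hdotC -adjointP -hdotC. Qed.

Lemma adjointD x y : (x + y)^† = x^† + y^†.
Proof.
apply/esym/adjoint_unique => u v.
by rewrite !bounded_addE hdotDl hdotDr !adjointP.
Qed.

Lemma adjointZ a x : (a *: x)^† = Num.conj a *: x^†.
Proof.
apply/esym/adjoint_unique => u v.
by rewrite !bounded_scaleE hdotZl hdotZr adjointP conjCK.
Qed.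

Lemma adjointN x : (- x)^† = - x^†.
Proof. by rewrite -scaleN1r adjointZ rmorphN rmorph1 scaleN1r. Qed.

Lemma adjoint_comp (y : bounded_op H2 H3) x : (y \c x)^† = x^† \c y^†.
Proof. by apply/esym/adjoint_unique => u v /=; rewrite !adjointP. Qed.

Lemma adjoint_id : (bounded_id H1)^† = bounded_id H1.
Proof. exact/esym/adjoint_unique. Qed.

Lemma adjoint0 : (0 : bounded_op H1 H2)^† = 0.
Proof.
by apply/esym/adjoint_unique => u v; rewrite !bounded_zeroE hdot0l hdot0r.
Qed.

End OperatorAlgebra.

(** * Halving a Hilbert space by partial isometries *)

Section PartialIsometries.
Variables (R : realType) (H : hilbertType R).

Lemma hdot_eq0 (u : H) : hdot u u = 0 -> u = 0.
Proof.
by rewrite hdot_norm => /eqP; rewrite sqrf_eq0 normr_eq0 => /eqP.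
Qed.

Lemma exists_unit (u : H) : u != 0 ->
  exists c : R[i], hdot (c *: u) (c *: u) = 1.
Proof.
move=> u0; exists `|u|^-1.
rewrite hdot_norm normrZ normfV normr_id mulVf ?expr1n//.
by rewrite normr_eq0.
Qed.

(** The pair over the nearest point is unique: a difference of two candidates has first coordinate
    0, hence second coordinate 0 by isometry. Uniqueness gives linearity, and Pythagoras gives the
    norm bound. Keeping the whole pair records the projection together with its image. *)
Lemma isometric_relation_projection (G : set (H * H)) :
  G 0 -> (forall a g h, G g -> G h -> G (a *: g + h)) ->
  (forall g, G g -> hdot g.1 g.1 = hdot g.2 g.2) -> closed G ->
  exists s : H -> H * H,
    [/\ linear s, forall x, G (s x),
        forall x h, G h -> hdot (s x).1 h.1 = hdot x h.1,
        forall x, `|(s x).1| <= `|x| &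
        forall x g, G g -> (forall h, G h -> hdot g.1 h.1 = hdot x h.1) -> s x = g].
Proof.
move=> G0 Glin Giso Gclosed.
have GB g h : G g -> G h -> G (g - h).
  by move=> Gg Gh; rewrite addrC -scaleN1r; exact: Glin.
have /choice[s sP] x : exists g, G g /\ forall h, G h -> hdot (x - g.1) h.1 = 0.
  by have [g] := isometric_relation_proj G0 Glin Giso Gclosed x; exists g.
have Gs x : G (s x) by case: (sP x).
have s_fst y h : G h -> hdot (s y).1 h.1 = hdot y h.1.
  move=> Gh; have := (sP y).2 h Gh; rewrite hdotDl hdotNl => /eqP.
  by rewrite subr_eq0 => /eqP.
have s_uniq x g : G g -> (forall h, G h -> hdot g.1 h.1 = hdot x h.1) -> s x = g.
  move=> Gg gP; apply/eqP; rewrite -subr_eq0; apply/eqP.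
  have Gd := GB _ _ (Gs x) Gg.
  have d0 : hdot (s x - g).1 (s x - g).1 = 0.
    by rewrite [X in hdot X _]/= hdotDl hdotNl s_fst// gP// subrr.
  have := d0; rewrite Giso// => /hdot_eq0; move: d0 => /hdot_eq0.
  by case: (s x - g) => a b /= -> ->.
exists s; split => // [a x y|x].
  apply: s_uniq => [|h Gh]; first exact: Glin.
  by rewrite /= !hdotDl !hdotZl !s_fst.
rewrite -(@ler_pXn2r _ 2)// ?nnegrE// -!hdot_norm.
have -> : hdot x x = hdot (s x).1 (s x).1 + hdot (x - (s x).1) (x - (s x).1).
  have e := s_fst x _ (Gs x); have e' := (sP x).2 _ (Gs x).
  rewrite hdotDr hdotNr e' oppr0 addr0 hdotDl hdotNl.
  by rewrite (hdotC (s x).1 x) -e -hdotC addrC subrK.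
by rewrite lerDl hdot_norm exprn_ge0.
Qed.

(* The maximal shift relation is the graph of a partial isometry [u] whose
   initial and final spaces are orthogonal, and no two orthogonal nonzero
   vectors are left outside: they could be added to the relation. *)
Lemma max_shift_isometry : exists u : bounded_op H H,
  [/\ u \c u^† \c u = u, u \c u = 0 &
      forall c d, u c = 0 -> u^† c = 0 -> u d = 0 -> u^† d = 0 ->
        hdot c d = 0 -> c != 0 -> d = 0].
Proof.
have [G [Gshift G0 Gclosed Gmax]] := shift_relation_max H.
have [Glin Gort] := Gshift.
have Giso g : G g -> hdot g.1 g.1 = hdot g.2 g.2.
  by move=> Gg; exact: (Gort _ _ Gg Gg).2.
have [s [s_lin Gs s_fst s_le s_uniq]] :=
  isometric_relation_projection G0 Glin Giso Gclosed.
(* The inverse relation is also closed and isometric; its projection [t] is onto the final space,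
   and the first coordinate of [t] is the adjoint of [u]. *)
pose swap (g : H * H) := (g.2, g.1).
have swapc : closed (swap @^-1` G).
  apply: (continuous_closedP swap).1 => //.
  by apply: pair_continuous => g; [exact: cvg_snd|exact: cvg_fst].
have [t [t_lin Gt t_snd t_le t_uniq]] : exists t : H -> H * H,
    [/\ linear t, forall x, G (t x),
        forall x h, G h -> hdot (t x).2 h.2 = hdot x h.2,
        forall x, `|(t x).2| <= `|x| &
        forall x g, G g -> (forall h, G h -> hdot g.2 h.2 = hdot x h.2) -> t x = g].
  have [||t [t_lin Gt t_fst t_le t_uniq]] :=
    @isometric_relation_projection (swap @^-1` G) G0 _ _ swapc.
  - by move=> a g h; exact: Glin.
  - by move=> [a b] /Giso.
  exists (swap \o t); split=> // [a x y|x [h1 h2] Gh|x [g1 g2] Gg gP].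
  - by rewrite /= t_lin.
  - exact: (t_fst x (h2, h1)).
  - by rewrite /= (t_uniq x (g2, g1))// => -[h1 h2] Gh; exact: (gP (h2, h1)).
have s_norm x : `|(s x).2| = `|(s x).1|.
  by apply/eqP; rewrite -(@eqrXn2 _ 2)// -!hdot_norm Giso.
have t_norm x : `|(t x).1| = `|(t x).2|.
  by apply/eqP; rewrite -(@eqrXn2 _ 2)// -!hdot_norm Giso.
have u_bounded : snd \o s \in @bounded_linear R H H.
  rewrite inE; split=> [a x y|]; first by rewrite /= s_lin.
  by exists 1 => x /=; rewrite mul1r s_norm.
have v_bounded : fst \o t \in @bounded_linear R H H.
  rewrite inE; split=> [a x y|]; first by rewrite /= t_lin.
  by exists 1 => x /=; rewrite mul1r t_norm.
pose u := BoundedOp u_bounded; exists u.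
have uA : u^† = BoundedOp v_bounded.
  apply/esym/adjoint_unique => x y /=.
  rewrite hdotC -(t_snd y _ (Gs x)) -hdotC -(Gort _ _ (Gs x) (Gt y)).2.
  exact: s_fst.
have t_s x : t (s x).2 = s x by exact: t_uniq.
have s_s x : s (s x).1 = s x by exact: s_uniq.
split.
- by apply/bounded_op_eqP => x; rewrite uA /= t_s s_s.
- apply/bounded_op_eqP => x /=; rewrite (s_uniq _ 0)// => h Gh.
  by rewrite hdot0l hdotC (Gort _ _ Gh (Gs x)).1 rmorph0.
move=> c d uc0 vc0 ud0 vd0 cd c_neq0; apply/eqP; apply: contraT => d_neq0.
(* The kernels of [u] and [u^†] are orthogonal to the domain and the range of [G]. Hence, after
   normalization, the pair made of [c] and [d] could be adjoined to [G]; by maximality it is already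
   there, and then [c] is orthogonal to itself. *)
have sG x g : u x = 0 -> G g -> hdot x g.1 = 0.
  move=> ux0 Gg; rewrite -s_fst// (_ : (s x).1 = 0) ?hdot0l//.
  by apply/eqP; rewrite -normr_eq0 -s_norm [(s x).2]ux0 normr0.
have tG y g : u^† y = 0 -> G g -> hdot y g.2 = 0.
  rewrite uA => vy0 Gg; rewrite -t_snd// (_ : (t y).2 = 0) ?hdot0l//.
  by apply/eqP; rewrite -normr_eq0 -t_norm [(t y).1]vy0 normr0.
have [a ac] := exists_unit c_neq0; have [b bd] := exists_unit d_neq0.
have /Gmax GK : shift_relation
    [set k | exists e, exists2 g, G g & k = e *: (a *: c, b *: d) + g].
  apply: shift_relation_extend => // [||g Gg].
  - by rewrite hdotZl hdotZr cd !mulr0.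
  - by rewrite ac bd.
  by rewrite !hdotZl (sG c)// (sG d)// (tG c)// (tG d)// !mulr0.
have : G (a *: c, b *: d).
  apply: GK => [g Gg|]; first by exists 0, g => //; rewrite scale0r add0r.
  by exists 1, 0 => //; rewrite scale1r addr0.
move=> /(sG _ _ uc0) /= c0; move: ac; rewrite hdotZl c0 mulr0 => /eqP.
by rewrite eq_sym oner_eq0.
Qed.

End PartialIsometries.

Section Halving.
Variables (R : realType) (H : hilbertType R).

Lemma bounded_opN (V W : normedModType R[i]) (x : bounded_op V W) u :
  x (- u) = - x u.
Proof. by rewrite -scaleN1r bounded_opZ scaleN1r. Qed.

Lemma exists_orthogonal_pair : dim_ge 2 H ->
  exists c d : H, [/\ c != 0, d != 0 & hdot c d = 0].
Proof.
move=> [e eP].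
have free a b : a *: e ord0 + b *: e ord_max = 0 -> a = 0 /\ b = 0.
  move=> ab0; pose c (i : 'I_2) := if i == ord0 then a else b.
  have ce0 : \sum_(i < 2) c i *: e i = 0.
    by rewrite big_ord_recr big_ord1 /= -[RHS]ab0; congr (_ *: e _ + _); exact: val_inj.
  by split; [exact: (eP c ce0 ord0)|exact: (eP c ce0 ord_max)].
have c0 : e ord0 != 0.
  apply/eqP => e0; have [] := free 1 0; first by rewrite e0 scaler0 scale0r addr0.
  by move=> /eqP; rewrite oner_eq0.
have cc0 : hdot (e ord0) (e ord0) != 0 by apply: contra_neq c0; exact: hdot_eq0.
pose b := hdot (e ord_max) (e ord0) / hdot (e ord0) (e ord0).
exists (e ord0), (e ord_max - b *: e ord0); split => //.
  apply/eqP => e0; have [] := free (- b) 1; first by rewrite scaleNr scale1r addrC.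
  by move=> _ /eqP; rewrite oner_eq0.
by rewrite hdotC hdotDl hdotNl hdotZl divfK// subrr rmorph0.
Qed.

Lemma bounded_rank_one_subproof (c d : H) :
  (fun x => hdot x c *: d) \in @bounded_linear R H H.
Proof.
rewrite inE; split=> [a x y|]; first by rewrite hdotDl hdotZl scalerDl scalerA.
exists (complex.Re `|c| * complex.Re `|d|) => x.
rewrite normrZ realcM !nrmE mulrAC ler_wpM2r// mulrC; exact: hdot_le.
Qed.

Definition rank_one (c d : H) := BoundedOp (bounded_rank_one_subproof c d).

Lemma adjoint_rank_one (c d : H) : (rank_one c d)^† = rank_one d c.
Proof.
apply/esym/adjoint_unique => x y /=.
by rewrite hdotZl hdotZr -hdotC mulrC.
Qed.

Lemma halving : dim_ge 2 H -> exists u w : bounded_op H H,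
  [/\ u \c u^† \c u = u, u \c u = 0, w \c w^† \c w = w, w \c w = 0 &
      u^† \c u \c w = w /\ u^† \c u + u \c u^† + w^† \c w = bounded_id H].
Proof.
move=> /exists_orthogonal_pair[e1 [e2 [e1_neq0 e2_neq0 e12]]].
have [u [uuu uu umax]] := max_shift_isometry H; exists u.
have uuuE x : u (u^† (u x)) = u x by rewrite -[in RHS]uuu.
have uuE x : u (u x) = 0 by rewrite -[LHS]/((u \c u) x) uu.
have vvE x : u^† (u^† x) = 0.
  by rewrite -[LHS]/((u^† \c u^†) x) -adjoint_comp uu adjoint0.
have vuvE x : u^† (u (u^† x)) = u^† x.
  have e : u^† \c (u \c u^†) = u^†.
    by rewrite -[in RHS]uuu !adjoint_comp adjointK bounded_compA.
  by rewrite -[LHS]/((u^† \c (u \c u^†)) x) e.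
(* The projection onto the common kernel of [u] and [u^†], which has dimension at most one. *)
pose r x := x - u^† (u x) - u (u^† x).
have ur x : u (r x) = 0.
  by rewrite /r !bounded_opD !bounded_opN uuuE uuE oppr0 addr0 subrr.
have vr x : u^† (r x) = 0.
  by rewrite /r !bounded_opD !bounded_opN vuvE vvE subr0 subrr.
have rE x : x = u^† (u x) + u (u^† x) + r x.
  by rewrite /r -(addrA x) -opprD [RHS]addrC subrK.
have [r0|/existsNP[x /eqP rx0]] := pselect (forall x, r x = 0).
  exists 0; rewrite !(adjoint0, bounded_comp0r, bounded_comp0l); split=> //; split=> //.
  apply/bounded_op_eqP => x; rewrite addr0 bounded_addE /=.
  by rewrite [RHS]rE r0 addr0.
have [c [uc vc cc]] : exists c, [/\ u c = 0, u^† c = 0 & hdot c c = 1].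
  have [a ac] := exists_unit rx0; exists (a *: r x); split=> //.
    by rewrite bounded_opZ ur scaler0.
  by rewrite bounded_opZ vr scaler0.
have c_neq0 : c != 0.
  by apply: contra_eq_neq cc => ->; rewrite hdot0l eq_sym oner_eq0.
(* If [u] were 0, the common kernel would be all of [H] and contain the orthogonal pair [e1],
   [e2]. *)
have [y uy0] : exists y, u y != 0.
  apply: contrapT => u0; have {}u0 y : u y = 0.
    by apply/eqP; apply: contrapT => /negP uy; apply: u0; exists y.
  have v0 y : u^† y = 0.
    by apply: hdotr_inj => z; rewrite -adjointP u0 hdot0l hdot0r.
  have := umax e1 e2 (u0 _) (v0 _) (u0 _) (v0 _) e12 e1_neq0.
  by apply/eqP.
have vuy0 : u^† (u y) != 0.
  by apply: contra_neq uy0 => vuy0; rewrite -uuuE vuy0 bounded_op0.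
have [d [ud dd]] : exists d, u^† (u d) = d /\ hdot d d = 1.
  have [b bd] := exists_unit vuy0; exists (b *: u^† (u y)); split=> //.
  by rewrite !bounded_opZ uuuE.
have dc : hdot d c = 0 by rewrite -ud hdotC -adjointP uc hdot0l rmorph0.
(* This [w] sends the unit vector [c] of the leftover line to a unit vector [d] of the initial space
   of [u], so [w^† w] is the projection onto that line. *)
exists (rank_one c d); rewrite adjoint_rank_one; split=> //.
- by apply/bounded_op_eqP => z /=; rewrite !hdotZl dd cc !mulr1.
- by apply/bounded_op_eqP => z /=; rewrite hdotZl dc mulr0 scale0r.
split; apply/bounded_op_eqP => z; first by rewrite /= !bounded_opZ ud.
rewrite !bounded_addE /= hdotZl dd mulr1 [RHS]rE; congr (_ + _).
have -> : hdot z c = hdot (r z) c.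
  by rewrite /r !hdotDl !hdotNl !adjointP adjointK uc vc !bounded_op0 !hdot0r !subr0.
apply/esym/eqP; rewrite -subr_eq0; apply/eqP.
apply: (umax c _ uc vc _ _ _ c_neq0).
- by rewrite -scaleNr bounded_opD bounded_opZ ur uc scaler0 addr0.
- by rewrite -scaleNr bounded_opD bounded_opZ vr vc scaler0 addr0.
by rewrite hdotC hdotDl hdotNl hdotZl cc mulr1 subrr rmorph0.
Qed.

End Halving.

(** * Biadditivity of the second difference *)

Section Defect.
Variables (V G : zmodType) (f : V -> G).

Definition defect (x y : V) : G := f (x + y) - (f x + f y).

Lemma defectC x y : defect x y = defect y x.
Proof. by rewrite /defect (addrC x) (addrC (f x)). Qed.

(** Both sides are [f (x + y + z) - f x - f y - f z]. *)
Lemma defect_cocycle x y z :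
  defect x y + defect (x + y) z = defect y z + defect x (y + z).
Proof.
have cancel (a b c e : G) : (a - b) + (c - (a + e)) = c - (b + e).
  by rewrite addrACA -opprD addrCA opprD addrACA subrr add0r.
rewrite /defect cancel (addrC (f x) (f (y + z))) cancel.
by rewrite addrA (addrC (_ + f z)) addrA.
Qed.

(** Adding the relation at [(y, y)] and at [(- y, - y)] shows that [h] is odd at [y + y], hence
    everywhere. It then reads [h (x + y) - h (x - y) = 2 h y]; exchanging [x] and [y] and adding
    gives twice the additivity. *)
Lemma additive_of_symmetric_difference (h : V -> G) :
  (forall g : G, g *+ 2 = 0 -> g = 0) -> (forall x : V, exists y, x = y + y) ->
  h 0 = 0 -> (forall x y, h (x + y) + h (- y) = h (x - y) + h y) ->
  additive_map h.
Proof.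
move=> G2 V2 h0 hP.
have hN x : h (- x) = - h x.
  have [y ->] := V2 x; apply/eqP; rewrite -addr_eq0; apply/eqP.
  have := hP y y; have := hP (- y) (- y); rewrite !opprK subrr addNr h0 !add0r opprD.
  by move=> e1 e2; apply: (addIr (h y)); rewrite addrAC e1 addrC e2 add0r.
move=> x y; apply/eqP; rewrite -subr_eq0; apply/eqP/G2.
have e1 : h (x + y) = h x *+ 2 - h (x - y).
  have := hP y x; rewrite hN (addrC y x) -[y - x]opprB hN => /eqP.
  by rewrite subr_eq => /eqP ->; rewrite -addrA -mulr2n addrC.
have e2 : h (x + y) = h (x - y) + h y *+ 2.
  have := hP x y; rewrite hN => /eqP.
  by rewrite subr_eq => /eqP ->; rewrite -addrA -mulr2n.
rewrite mulrnBl mulr2n {1}e1 e2 addrA subrK -mulrnDl subrr //.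
Qed.

End Defect.

(** * The second difference of an orthogonally additive map *)

Section OrthogonalAdditivity.
Variables (R : realType) (H1 H2 : hilbertType R) (G : zmodType).
Variable f : bounded_op H1 H2 -> G.
Hypothesis f_orth : orthogonally_additive f.
Hypothesis G2 : forall g : G, g *+ 2 = 0 -> g = 0.
Implicit Types x y z a b : bounded_op H1 H2.

Lemma orthogonally_additive0 : f 0 = 0.
Proof.
have /f_orth : op_orthogonal (0 : bounded_op H1 H2) 0 by exact: bounded_comp0r.
by rewrite addr0 => /eqP; rewrite -subr_eq subrr eq_sym => /eqP.
Qed.

Lemma bounded_op_half x : exists y, x = y + y.
Proof.
have e : 2^-1 *+ 2 = 1 :> R[i] by rewrite -[LHS]mulr_natl mulfV// pnatr_eq0.
by exists (2^-1 *: x); rewrite -scalerDl -mulr2n e scale1r.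
Qed.

Section Shift.
Variable v : bounded_op H2 H2.
Hypotheses (vvv : v \c v^† \c v = v) (vv : v \c v = 0).

Local Notation d x y := (defect f (v^† \c v \c x) (v^† \c v \c y)).
Local Notation "x *_v y" := (x^† \c (v^† \c v \c y)) (at level 40).

Lemma shift_orthogonal x y a b : x *_v y + a *_v b = 0 ->
  op_orthogonal (v^† \c v \c x + v \c a) (v^† \c v \c y + v \c b).
Proof.
have vv' : v^† \c v^† = 0 by rewrite -adjoint_comp vv adjoint0.
move=> xyab; rewrite /op_orthogonal adjointD !adjoint_comp adjointK.
have vvvE z : v \c (v^† \c (v \c z)) = v \c z by rewrite !bounded_compA vvv.
have vvE z : v \c (v \c z) = 0 by rewrite bounded_compA vv bounded_comp0l.
have vvE' z : v^† \c (v^† \c z) = 0 by rewrite bounded_compA vv' bounded_comp0l.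
rewrite !bounded_compDl !bounded_compDr -!bounded_compA vvvE vvE vvE'.
by rewrite !bounded_comp0r addr0 add0r !bounded_compA -xyab !bounded_compA.
Qed.

(** Anything of the form [v^† v p] is orthogonal to anything of the form [v q], so [f] splits on
    each of the two sums and on their total; orthogonality of the two sums then makes the two second
    differences cancel. *)
Lemma shift_defect x y a b : x *_v y + a *_v b = 0 ->
  d x y = - defect f (v \c a) (v \c b).
Proof.
have fE p q : f (v^† \c v \c p + v \c q) = f (v^† \c v \c p) + f (v \c q).
  have := @shift_orthogonal p 0 0 q; rewrite !bounded_comp0r addr0 add0r.
  by rewrite adjoint0 bounded_comp0l add0r => /(_ erefl)/f_orth.
move=> /shift_orthogonal/f_orth.
rewrite addrACA -!bounded_compDr !fE !bounded_compDr => /eqP.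
rewrite addrACA -subr_eq0 opprD addrACA => /eqP e.
by apply/eqP; rewrite -addr_eq0; apply/eqP.
Qed.

Lemma shift_defectE x y : d x y = - defect f (v \c (- x)) (v \c y).
Proof. by apply: shift_defect; rewrite adjointN bounded_compNl subrr. Qed.

(* Cocycle identity of the second difference at [v^* v x, v^* v y, v^* v z], minus
   that at [v (- x), v y, v z]. *)
Lemma shift_defect_additive z : additive_map (fun x => d x z).
Proof.
apply: additive_of_symmetric_difference => //.
- exact: bounded_op_half.
- by rewrite bounded_comp0r /defect add0r orthogonally_additive0 add0r subrr.
move=> x y; 
have shE s t : defect f (v \c (- s)) (v \c t) = - d s t.
  by rewrite shift_defectE opprK.
have c1 := defect_cocycle f (v^† \c v \c x) (v^† \c v \c y) (v^† \c v \c z).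
have c2 := defect_cocycle f (v \c (- x)) (v \c y) (v \c z).
rewrite -!bounded_compDr -[- x + y]opprK opprD opprK in c2.
rewrite -{3}[y]opprK !shE -!opprD in c2; move/oppr_inj: c2 => c2.
rewrite -!bounded_compDr in c1 *; apply: (addrI (d x y)).
by rewrite [LHS]addrA [RHS]addrA c1 c2 [LHS]addrAC [RHS]addrAC (addrC (d y z)).
Qed.

Lemma shift_defectN x y : d (- x) y = - d x y.
Proof.
apply/eqP; rewrite -addr_eq0 -shift_defect_additive addNr bounded_comp0r.
by rewrite /defect add0r orthogonally_additive0 add0r subrr.
Qed.

Lemma shift_defect_shift x y : d x y = defect f (v \c x) (v \c y).
Proof. by rewrite -[x in RHS]opprK -[RHS]opprK -shift_defectE shift_defectN opprK. Qed.

Lemma shift_defect_eq x y x' y' : x *_v y = x' *_v y' -> d x y = d x' y'.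
Proof.
move=> xy; rewrite (shift_defectE x'); apply: shift_defect.
by rewrite xy adjointN bounded_compNl subrr.
Qed.

End Shift.

Hypothesis H2_dim : dim_ge 2 H2.

Lemma defect_split (u w : bounded_op H2 H2) :
  u \c u^† \c u = u -> u \c u = 0 ->
  u^† \c u + u \c u^† + w^† \c w = bounded_id H2 -> forall x y,
  defect f x y = defect f (u^† \c u \c x) (u^† \c u \c y) +
    (defect f (u \c u^† \c x) (u \c u^† \c y) +
     defect f (w^† \c w \c x) (w^† \c w \c y)).
Proof.
move=> uuu uu puqr.
have vv : u^† \c u^† = 0 by rewrite -adjoint_comp uu adjoint0.
have pp : u^† \c u \c (u^† \c u) = u^† \c u.
  by rewrite -bounded_compA (bounded_compA u) uuu.
have pq : u^† \c u \c (u \c u^†) = 0.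
  by rewrite -bounded_compA (bounded_compA u u) uu bounded_comp0l bounded_comp0r.
have qp : u \c u^† \c (u^† \c u) = 0.
  by rewrite -bounded_compA (bounded_compA u^† u^†) vv bounded_comp0l bounded_comp0r.
have qq : u \c u^† \c (u \c u^†) = u \c u^†.
  by rewrite bounded_compA uuu.
(* Multiply the resolution of the identity by the projection [u^† u], which is already orthogonal to
   [u u^†]. *)
have pr : u^† \c u \c (w^† \c w) = 0.
  apply: (addrI (u^† \c u)); rewrite addr0 -[RHS]bounded_comp1r -puqr.
  by rewrite [RHS]bounded_compDr [X in _ = X + _]bounded_compDr pp pq addr0.
have qr : u \c u^† \c (w^† \c w) = 0.
  apply: (addrI (u \c u^†)); rewrite addr0 -[RHS]bounded_comp1r -puqr.
  by rewrite [RHS]bounded_compDr [X in _ = X + _]bounded_compDr qp qq add0r.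
have f_split x : f x = f (u^† \c u \c x) +
    (f (u \c u^† \c x) + f (w^† \c w \c x)).
  rewrite -{1}[x]bounded_comp1l -puqr !bounded_compDl -addrA f_orth.
    congr (_ + _); apply: f_orth; rewrite /op_orthogonal !adjoint_comp adjointK.
    by rewrite -(bounded_compA x^†) (bounded_compA (u \c u^†)) qr
      bounded_comp0l bounded_comp0r.
  rewrite /op_orthogonal !adjoint_comp adjointK bounded_compDr.
  rewrite -!(bounded_compA x^†) (bounded_compA _ (u \c u^†)) pq.
  rewrite (bounded_compA _ (w^† \c w)) pr.
  by rewrite !(bounded_comp0l, bounded_comp0r) addr0.
move=> x y; rewrite /defect f_split (f_split x) (f_split y) !bounded_compDr.
have ACA (a b c e : G) : a + b - (c + e) = (a - c) + (b - e).
  by rewrite opprD addrACA.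
have regroup (a b c a1 b1 c1 a2 b2 c2 : G) :
    a + (b + c) - ((a1 + (b1 + c1)) + (a2 + (b2 + c2))) =
    (a - (a1 + a2)) + ((b - (b1 + b2)) + (c - (c1 + c2))).
  by rewrite (addrACA a1) (addrACA b1) !ACA.
exact: regroup.
Qed.

Lemma defect_additive z : additive_map (fun x => defect f x z).
Proof.
have [u [w [uuu uu www ww [uuw puqr]]]] := halving H2_dim.
have vvv : u^† \c u^†^† \c u^† = u^†.
  by rewrite -[in RHS]uuu !adjoint_comp adjointK bounded_compA.
have vv : u^† \c u^† = 0 by rewrite -adjoint_comp uu adjoint0.
have dE x : defect f x z = defect f (u^† \c u \c x) (u^† \c u \c z) +
    (defect f (u^†^† \c u^† \c x) (u^†^† \c u^† \c z) +
     defect f (w^† \c w \c x) (w^† \c w \c z)).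
  by rewrite adjointK; exact: defect_split.
move=> x y; rewrite (dE (x + y)) (dE x) (dE y).
rewrite (shift_defect_additive uuu uu) (shift_defect_additive vvv vv).
rewrite (shift_defect_additive www ww) [RHS]addrACA.
by congr (_ + _); exact: addrACA.
Qed.

End OrthogonalAdditivity.

(** * Existence and uniqueness of the decomposition *)

Section Decomposition.
Variables (R : realType) (H1 H2 : hilbertType R) (G : zmodType).
Variable f : bounded_op H1 H2 -> G.
Hypothesis G2 : forall g : G, g *+ 2 = 0 -> g = 0.
Implicit Types (x y : bounded_op H1 H2) (T : bounded_op H1 H2 -> G).

(** The difference [T - T'] is additive and also the diagonal of a biadditive map, so doubling [x]
    multiplies it both by 2 and by 4. *)
Lemma quadratic_decomposition_unique T T' :
  quadratic_decomposition f T -> quadratic_decomposition f T' -> T = T'.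
Proof.
move=> [TD [B [_ Bbi _ fB]]] [T'D [B' [_ B'bi _ fB']]].
apply/funext => x; apply/eqP; rewrite -subr_eq0; apply/eqP/G2.
have TB z : T z - T' z = B' z z - B z z.
  have e : T' z + B' z z = T z + B z z by rewrite -fB fB'.
  by rewrite -[T z](addrK (B z z)) -e addrAC (addrC (T' z)) addrK.
have quad C : biadditive_map C -> C (x + x) (x + x) = C x x *+ 2 + C x x *+ 2.
  by move=> [Cl Cr]; rewrite [LHS]Cl !Cr mulr2n.
have q4 : T (x + x) - T' (x + x) = (T x - T' x) *+ 2 + (T x - T' x) *+ 2.
  by rewrite !TB !quad// !mulrnBl opprD addrACA.
have q2 : T (x + x) - T' (x + x) = (T x - T' x) *+ 2.
  by rewrite TD T'D mulrnBl !mulr2n.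
by apply: (addrI ((T x - T' x) *+ 2)); rewrite addr0 -q4.
Qed.

Hypothesis f_orth : orthogonally_additive f.
Hypothesis H2_dim : dim_ge 2 H2.

Lemma defect_additiver x : additive_map (defect f x).
Proof.
by move=> y z; rewrite !(defectC f x) defect_additive.
Qed.

Lemma defect_orthogonal x y : op_orthogonal x y -> defect f x y = 0.
Proof. by move=> xy; rewrite /defect f_orth// subrr. Qed.

Lemma quadratic_decomposition_half (half : G -> G) :
  (forall g, half g *+ 2 = g) ->
  quadratic_decomposition f (fun x => f x - half (defect f x x)).
Proof.
move=> halfK.
have inj (g h : G) : g *+ 2 = h *+ 2 -> g = h.
  move=> gh; apply/eqP; rewrite -subr_eq0; apply/eqP/G2.
  by rewrite mulrnBl gh subrr.
have halfD : additive_map half by move=> g h; apply: inj; rewrite mulrnDl !halfK.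
have half0 : half 0 = 0 by apply: inj; rewrite halfK mul0rn.
split.
  move=> x y.
  have -> : half (defect f (x + y) (x + y)) =
      half (defect f x x) + half (defect f y y) + defect f x y.
    rewrite defect_additive// !defect_additiver// (defectC f y x).
    move: (defect f x x) (defect f x y) (defect f y y) => a b c.
    by rewrite !halfD -[X in _ = _ + X]halfK mulr2n (addrC (half b) (half c)) addrACA.
  have -> : f (x + y) = f x + f y + defect f x y by rewrite [RHS]addrC /defect subrK.
  by rewrite opprD addrACA subrr addr0 opprD addrACA.
exists (fun x y => half (defect f x y)); split.
- by move=> x y; rewrite defectC.
- by split=> [y x z|x y z]; rewrite ?defect_additive ?defect_additiver// halfD.
- by move=> x y /defect_orthogonal ->.
by move=> x; rewrite subrK.
Qed.

End Decomposition.

(** * Balanced operators *)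

Section Balanced.
Variables (R : realType) (H1 H2 : hilbertType R) (G : zmodType).
Variable f : bounded_op H1 H2 -> G.
Hypothesis f_orth : orthogonally_additive f.
Hypothesis G2 : forall g : G, g *+ 2 = 0 -> g = 0.
Hypothesis H2_dim : dim_ge 2 H2.
Implicit Types (x y : bounded_op H1 H2) (a b v w : bounded_op H2 H2).

Definition balanced a : Prop :=
  forall x y, defect f (a \c x) y = defect f x (a^† \c y).

Lemma balancedD a b : balanced a -> balanced b -> balanced (a + b).
Proof.
move=> aP bP x y; rewrite adjointD !bounded_compDl defect_additive//.
by rewrite defect_additiver// aP bP.
Qed.

Lemma balanced_comp a b : balanced a -> balanced b -> balanced (a \c b).
Proof.
move=> aP bP x y; rewrite adjoint_comp -!bounded_compA. exact: etrans (aP _ _) (bP _ _).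
Qed.

Lemma balanced_adjoint a : balanced a -> balanced a^†.
Proof. by move=> aP x y; rewrite adjointK defectC -aP defectC. Qed.

(** The ranges of [a] and [1 - a] are orthogonal, so both sides equal the second difference at
    [a x], [a y]. *)
Lemma balanced_projection a : a^† = a -> a \c a = a -> balanced a.
Proof.
move=> aA aa x y; rewrite aA.
have split (z : bounded_op H1 H2) : z = a \c z + (z - a \c z) by rewrite addrC subrK.
have orth (z t : bounded_op H1 H2) : op_orthogonal (a \c z) (t - a \c t).
  rewrite /op_orthogonal adjoint_comp aA bounded_compDr bounded_compNr.
  by rewrite -!bounded_compA (bounded_compA a) aa subrr.
rewrite {1}[y]split {2}[x]split defect_additive// defect_additiver//.
rewrite (defectC f (x - _)) (defect_orthogonal f_orth (orth x y)).
by rewrite (defect_orthogonal f_orth (orth y x)).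
Qed.

Section Shift.
Variable v : bounded_op H2 H2.
Hypotheses (vvv : v \c v^† \c v = v) (vv : v \c v = 0).

Lemma balanced_initial : balanced (v^† \c v).
Proof.
apply: balanced_projection; first by rewrite adjoint_comp adjointK.
by rewrite -bounded_compA (bounded_compA v) vvv.
Qed.

Lemma balanced_final : balanced (v \c v^†).
Proof.
apply: balanced_projection; first by rewrite adjoint_comp adjointK.
by rewrite bounded_compA vvv.
Qed.

Let vvvE (z : bounded_op H1 H2) : v^† \c v \c (v^† \c v \c z) = v^† \c v \c z.
Proof.
by rewrite -!bounded_compA (bounded_compA v v^†) (bounded_compA (v \c v^†)) vvv.
Qed.

Let adjoint_initial : (v^† \c v)^† = v^† \c v.
Proof. by rewrite adjoint_comp adjointK. Qed.

(** With [p = v^† v], the second difference at [p x], [p y] depends only on [x^† p y], and replacing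
    [x] by [a p x] there has the same effect as replacing [y] by [a^† p y] once [y] is compressed by
    [p]. *)
Lemma balanced_corner a : balanced (v^† \c v \c a \c (v^† \c v)).
Proof.
move=> x y; have -> : v^† \c v \c a \c (v^† \c v) \c x =
    v^† \c v \c (a \c (v^† \c v \c x)) by rewrite !bounded_compA.
have -> : (v^† \c v \c a \c (v^† \c v))^† \c y =
    v^† \c v \c (a^† \c (v^† \c v \c y)).
  by rewrite !adjoint_comp !adjointK !bounded_compA.
rewrite -{1}vvvE balanced_initial adjoint_initial.
rewrite (shift_defect_eq f_orth vvv vv (x' := x) (y' := a^† \c (v^† \c v \c y))).
  by rewrite balanced_initial adjoint_initial vvvE.
by rewrite !adjoint_comp !adjointK !bounded_compA.
Qed.

(** Compress [y] to [v v^† y] by the final projection, drop the common factor [v] in favour of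
    [v^† v], and use [v^† v v^† = v^†]. *)
Lemma balanced_shift : balanced v.
Proof.
move=> x y; have vE (z : bounded_op H1 H2) : v \c (v^† \c (v \c z)) = v \c z.
  by rewrite !bounded_compA vvv.
rewrite -vE bounded_compA balanced_final adjoint_comp adjointK -bounded_compA.
rewrite -(shift_defect_shift f_orth G2 vvv vv) balanced_initial adjoint_initial.
have vvv' : v^† \c v \c v^† = v^†.
  by rewrite -[in RHS]vvv !adjoint_comp adjointK bounded_compA.
by rewrite vvvE bounded_compA vvv'.
Qed.

End Shift.

(* With [p = u^* u], the operator [a] is a sum of products [s^* (p s a t^* p) t]
   where [s] and [t] range over [p], [u^*] and [w]. *)
Lemma balanced_all a : balanced a.
Proof.
have [u [w [uuu uu www ww [uuw puqr]]]] := halving H2_dim.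
have vvv : u^† \c u^†^† \c u^† = u^†.
  by rewrite -[in RHS]uuu !adjoint_comp adjointK bounded_compA.
have vv : u^† \c u^† = 0 by rewrite -adjoint_comp uu adjoint0.
have block s t : u^† \c u \c s = s -> u^† \c u \c t = t ->
    balanced s -> balanced t -> balanced (s^† \c s \c a \c (t^† \c t)).
  move=> us ut sP tP.
  have : balanced (s^† \c (u^† \c u \c (s \c a \c t^†) \c (u^† \c u)) \c t).
    apply: balanced_comp tP; apply: balanced_comp; first exact: balanced_adjoint.
    exact: balanced_corner.
  have ut' : t^† \c (u^† \c u) = t^†.
    by rewrite -[in RHS]ut !adjoint_comp adjointK bounded_compA.
  have -> : u^† \c u \c (s \c a \c t^†) \c (u^† \c u) = s \c a \c t^†.
    rewrite (bounded_compA (u^† \c u)) (bounded_compA (u^† \c u)) us.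
    by rewrite -(bounded_compA _ t^†) ut'.
  by rewrite !bounded_compA.
have pP := balanced_initial uuu.
have uP := balanced_shift vvv vv.
have wP := balanced_shift www ww.
have pp : u^† \c u \c (u^† \c u) = u^† \c u.
  by rewrite -bounded_compA (bounded_compA u) uuu.
have pu : u^† \c u \c u^† = u^† by rewrite -{2}(adjointK u) vvv.
have idE : bounded_id H2 = (u^† \c u)^† \c (u^† \c u) + u^†^† \c u^† + w^† \c w.
  by rewrite adjoint_comp adjointK pp -puqr.
have row s : u^† \c u \c s = s -> balanced s -> balanced (s^† \c s \c a).
  move=> us sP; rewrite -[X in balanced X]bounded_comp1r idE !bounded_compDr.
  by apply: balancedD; [apply: balancedD|]; exact: block.
rewrite -[a]bounded_comp1l idE !bounded_compDl.
by apply: balancedD; [apply: balancedD|]; exact: row.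
Qed.

End Balanced.

(** * The continuous case *)

Section RealHomogeneous.
Variable R : realType.

Lemma scaler_real_continuous (V : normedModType R[i]) (v : V) :
  continuous (fun t : R => t%:C *: v).
Proof.
have v0 : 0 < complex.Re `|v| + 1.
  by rewrite ltr_wpDl// -ler0c RRe_real ?normr_real.
move=> t; apply/cvgrPdist_le => -[e e']; rewrite ltcE /= => /andP[/eqP -> e0].
near=> s; rewrite -scalerBl -rmorphB normrZ.
apply: (@le_trans _ _ (`|t - s|%:C * (complex.Re `|v| + 1)%:C)).
  rewrite normc_def /= expr0n /= addr0 sqrtr_sqr ler_wpM2l ?ler0c//.
  by rewrite rmorphD /= RRe_real ?normr_real// lerDl ler01.
rewrite -rmorphM lecR -ler_pdivlMr//; near: s.
by apply: cvgr_dist_le; [exact: cvg_id|rewrite divr_gt0].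
Unshelve. all: by end_near. Qed.

Lemma additive_map0 (V W : zmodType) (h : V -> W) : additive_map h -> h 0 = 0.
Proof. by move=> hD; apply: (addrI (h 0)); rewrite -hD !addr0. Qed.

Lemma additive_mapN (V W : zmodType) (h : V -> W) :
  additive_map h -> forall x, h (- x) = - h x.
Proof.
move=> hD x; apply/eqP.
by rewrite -addr_eq0 -hD addNr (additive_map0 hD).
Qed.

(** The additive map [k] measuring the failure vanishes at 1, hence at all rationals, hence on their
    closure. *)
Lemma additive_continuous_real (V W : normedModType R[i]) (h : V -> W) :
  additive_map h -> continuous h -> forall (t : R) v, h (t%:C *: v) = t%:C *: h v.
Proof.
move=> hD hc t v; pose k (s : R) := h (s%:C *: v) - s%:C *: h v.
have kB : zmod_morphism k.
  by move=> x y; rewrite /k rmorphB !scalerBl hD (additive_mapN hD) !opprD addrACA.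
have kc : continuous k.
  move=> s; apply: cvgB; last exact: scaler_real_continuous.
  apply: (@continuous_comp _ _ _ (fun s : R => s%:C *: v) h).
    exact: scaler_real_continuous.
  exact: hc.
pose K : {additive R -> W} := HB.pack k (GRing.isZmodMorphism.Build R W k kB).
have k1 : k 1 = 0 by rewrite /k rmorph1 !scale1r subrr.
have kq (q : rat) : k (ratr q) = 0.
  have : k (ratr q *~ denq q) = 0.
    rewrite -[ratr q *~ _]mulrzr /ratr divfK ?intr_eq0 ?denq_eq0//.
    by rewrite -[k _]/(K _) raddfMz -[K _]/(k 1) k1 mul0rz.
  rewrite -[k _]/(K _) raddfMz /= -scaler_int => /eqP.
  by rewrite scaler_eq0 intr_eq0 denq_eq0 /= => /eqP.
have k0 : closed (k @^-1` [set 0]).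
  apply: (continuous_closedP k).1 => //.
  exact/accessible_closed_set1/hausdorff_accessible/norm_hausdorff.
suff : k t = 0 by move=> /eqP; rewrite subr_eq0 => /eqP.
apply: contrapT => kt.
have [||s [ks [q _ qs]]] := @dense_rat R (~` (k @^-1` [set 0])).
- by exists t.
- exact: closed_openC.
by apply: ks; rewrite /= -qs kq.
Qed.

End RealHomogeneous.

Section Continuity.
Variables (K : numFieldType) (X : topologicalType) (V W : normedModType K).

Lemma scale_continuous (a : K) (g : X -> W) :
  continuous g -> continuous (fun x => a *: g x).
Proof. by move=> gc x; apply: cvgZr; exact: gc. Qed.

Lemma sub_continuous (g h : X -> W) :
  continuous g -> continuous h -> continuous (fun x => g x - h x).
Proof. by move=> gc hc x; apply: cvgB; [exact: gc|exact: hc]. Qed.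

Lemma add_continuous (g h : X -> W) :
  continuous g -> continuous h -> continuous (fun x => g x + h x).
Proof. by move=> gc hc x; apply: cvgD; [exact: gc|exact: hc]. Qed.

End Continuity.

Lemma defect_continuous (K : numFieldType) (X : topologicalType)
    (V W : normedModType K) (f : V -> W) (g h : X -> V) :
  continuous f -> continuous g -> continuous h ->
  continuous (fun x => defect f (g x) (h x)).
Proof.
move=> fc gc hc.
have comp (k : X -> V) : continuous k -> continuous (fun x => f (k x)).
  by move=> kc x; apply: (@continuous_comp _ _ _ k f); [exact: kc|exact: fc].
apply: sub_continuous; first by apply: comp; exact: add_continuous.
by apply: add_continuous; exact: comp.
Qed.

Lemma half_scale (R : realType) (V : lmodType R[i]) (v : V) : (2^-1 *: v) *+ 2 = v.
Proof. by rewrite -scaler_nat scalerA mulfV ?scale1r// pnatr_eq0. Qed.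

Lemma lmod_two_torsion_free (R : realType) (V : lmodType R[i]) (v : V) :
  v *+ 2 = 0 -> v = 0.
Proof.
by rewrite -scaler_nat => /eqP; rewrite scaler_eq0 pnatr_eq0 /= => /eqP.
Qed.

(** * The continuous linear map representing the quadratic part *)

Section Representation.
Variables (R : realType) (H : hilbertType R) (G : completeNormedModType R[i]).
Variable f : bounded_op H H -> G.
Hypothesis H_dim : dim_ge 2 H.
Hypothesis f_orth : orthogonally_additive f.
Hypothesis fc : continuous f.
Implicit Types x y s : bounded_op H H.

Let G2 : forall g : G, g *+ 2 = 0 -> g = 0.
Proof. exact: lmod_two_torsion_free. Qed.

Local Notation id1 := (bounded_id H).

Let mul_ii : 'i%C * 'i%C = -1 :> R[i].
Proof. by rewrite -expr2 sqr_i. Qed.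

Let conj_i : Num.conj ('i%C : R[i]) = - 'i%C.
Proof. by apply/eqP; rewrite eq_complex /= oppr0 !eqxx. Qed.

(** Write the first argument as [x] composed with the identity and move [x] across, every operator
    being balanced. *)
Lemma defect_adjoint_comp x : defect f x x = defect f id1 (x^† \c x).
Proof.
by rewrite -balanced_all// bounded_comp1r.
Qed.

(** Moving ['i s] across turns it into its adjoint [- 'i s], so by symmetry the value is its own
    opposite. *)
Lemma defect_imaginary s : s^† = s -> defect f id1 ('i%C *: s) = 0.
Proof.
move=> sA; apply: G2; rewrite mulr2n; apply/eqP; rewrite addr_eq0; apply/eqP.
have D := defect_additiver G2 f_orth H_dim id1.
rewrite -(additive_mapN D) -scaleNr -conj_i -{2}sA -adjointZ.
by rewrite -[_^†]bounded_comp1r -balanced_all// bounded_comp1r; exact: defectC.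
Qed.

Let L s := 2^-1 *: defect f id1 s.

Let LD : additive_map L.
Proof. by move=> x y; rewrite /L defect_additiver// scalerDr. Qed.

Let Lc : continuous L.
Proof.
apply/scale_continuous/defect_continuous => // x; [exact: cst_continuous|exact: cvg_id].
Qed.

Let LZ (t : R) s : L (t%:C *: s) = t%:C *: L s.
Proof. exact: additive_continuous_real. Qed.

(* The second term makes the real linear map [L] complex linear; it vanishes at
   self-adjoint [s]. *)
Definition quadratic_representative s : G := L s - 'i%C *: L ('i%C *: s).

Lemma quadratic_representative_linear : linear quadratic_representative.
Proof.
have D x y : quadratic_representative (x + y) =
    quadratic_representative x + quadratic_representative y.
  by rewrite /quadratic_representative scalerDr !LD scalerDr opprD addrACA.
have Zr (t : R) x : quadratic_representative (t%:C *: x) =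
    t%:C *: quadratic_representative x.
  have swap (V : lmodType R[i]) (v : V) : 'i%C *: (t%:C *: v) = t%:C *: ('i%C *: v).
    by rewrite !scalerA mulrC.
  by rewrite /quadratic_representative swap !LZ swap scalerBr.
have Zi x : quadratic_representative ('i%C *: x) = 'i%C *: quadratic_representative x.
  have ii (V : lmodType R[i]) (v : V) : 'i%C *: ('i%C *: v) = - v.
    by rewrite scalerA mul_ii scaleN1r.
  by rewrite /quadratic_representative scalerBr !ii (additive_mapN LD) scalerN !opprK addrC.
move=> a x y; rewrite D [a]complexE !scalerDl D Zr -!scalerA.
by rewrite Zi Zr.
Qed.

Lemma quadratic_representative_continuous : continuous quadratic_representative.
Proof.
have ic : continuous (fun x : bounded_op H H => 'i%C *: x).
  by apply: scale_continuous => x; exact: cvg_id.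
have iLc : continuous (fun x => L ('i%C *: x)).
  move=> x; apply: (@continuous_comp _ _ _ (fun x : bounded_op H H => 'i%C *: x) L).
    exact: ic.
  exact: Lc.
by apply: sub_continuous => //; exact: scale_continuous.
Qed.

Lemma quadratic_representativeE x :
  2^-1 *: defect f x x = quadratic_representative (x^† \c x).
Proof.
rewrite /quadratic_representative [L ('i%C *: _)]/L defect_imaginary; last first.
  by rewrite adjoint_comp adjointK.
by rewrite !scaler0 subr0 /L -defect_adjoint_comp.
Qed.

(** Expanding [x^† x] at [1 + x] shows that the difference [d] satisfies [d x + d x^† = 0]; the same
    at ['i x] gives [d x - d x^† = 0]. *)
Lemma linear_eq_adjoint_comp (Phi Psi : bounded_op H H -> G) :
  linear Phi -> linear Psi ->
  (forall x, Phi (x^† \c x) = Psi (x^† \c x)) -> forall s, Phi s = Psi s.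
Proof.
move=> Phi_lin Psi_lin PhiPsi s; pose d x := Phi x - Psi x.
have dD x y : d (x + y) = d x + d y.
  rewrite /d -[x]scale1r Phi_lin Psi_lin !scale1r opprD; exact: addrACA.
have d0 x : d (x^† \c x) = 0 by rewrite /d PhiPsi subrr.
have dZ a x : d (a *: x) = a *: d x.
  by rewrite -[a *: x]addr0 /d Phi_lin Psi_lin opprD addrACA -scalerBr -/(d 0)
    (additive_map0 dD) addr0.
have dA x : d x + d x^† = 0.
  have := d0 (id1 + x); rewrite adjointD adjoint_id bounded_compDl !bounded_compDr.
  rewrite bounded_comp1l bounded_comp1r bounded_comp1l !dD d0 addr0.
  by rewrite -{1}[id1]bounded_comp1r -{1}adjoint_id d0 add0r.
have dA' : d s - d s^† = 0.
  have := dA ('i%C *: s); rewrite adjointZ conj_i !dZ scaleNr -scalerBr => /eqP.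
  by rewrite scaler_eq0 => /orP[/eqP i0|/eqP//]; move: mul_ii; rewrite i0 mul0r => /eqP;
    rewrite eq_sym oppr_eq0 oner_eq0.
apply/eqP; rewrite -subr_eq0; apply/eqP/G2; rewrite -/(d s) mulr2n.
by rewrite -[X in _ + X](subrK (d s^†)) dA' add0r dA.
Qed.

End Representation.

Theorem proposition6p1 (R : realType) :
  (forall (H1 H2 : hilbertType R) (G : zmodType)
      (f : bounded_op H1 H2 -> G),
    dim_ge 2 H1 -> dim_ge 2 H2 ->
    uniquely_divisible 2 G ->
    orthogonally_additive f ->
    exists! T : bounded_op H1 H2 -> G, quadratic_decomposition f T)
  /\
  (forall (H : hilbertType R) (G : completeNormedModType R[i])
      (f : bounded_op H H -> G),
    dim_ge 2 H ->
    orthogonally_additive f ->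
    continuous f ->
    exists T : bounded_op H H -> G,
      [/\ unique (quadratic_decomposition f) T,
          continuous T &
          exists! Phi : bounded_op H H -> G,
            [/\ linear Phi, continuous Phi &
                forall x, f x = T x + Phi (bounded_comp (adjoint x) x)]]).
Proof.
split=> [H1 H2 G f _ H2_dim G_div f_orth|H G f H_dim f_orth fc].
  have G2 (g : G) : g *+ 2 = 0 -> g = 0.
    have [h [h0 h_uniq]] := G_div 0 => g0.
    (* Both [g] and 0 are halves of 0. *)
    by rewrite -(h_uniq g g0) (h_uniq 0 (mul0rn _ _)).
  have /choice[half halfK] (g : G) : exists h, h *+ 2 = g.
    by have [h []] := G_div g; exists h.
  have quad := quadratic_decomposition_half G2 f_orth H2_dim halfK.
  by exists (fun x => f x - half (defect f x x)); split=> // T;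
    exact: quadratic_decomposition_unique.
have G2 : forall g : G, g *+ 2 = 0 -> g = 0 by exact: lmod_two_torsion_free.
have quad := quadratic_decomposition_half G2 f_orth H_dim (@half_scale R G).
exists (fun x => f x - 2^-1 *: defect f x x); split.
- by split=> // T; exact: quadratic_decomposition_unique.
- apply: sub_continuous => //; apply/scale_continuous/defect_continuous => // x; exact: cvg_id.
exists (quadratic_representative f); split.
  split; first exact: quadratic_representative_linear.
    exact: quadratic_representative_continuous.
  by move=> x; rewrite -quadratic_representativeE// subrK.
(* Since [T] is fixed, two representing maps agree on every [x^† x], hence everywhere by
   linearity. *)
move=> Phi [Phi_lin _ fE]; apply/funext/linear_eq_adjoint_comp => //.
  exact: quadratic_representative_linear.
move=> x; apply: (addrI (f x - 2^-1 *: defect f x x)).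
by rewrite -fE -quadratic_representativeE// subrK.
Qed.
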